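(* Let $\Lambda$ be an artin algebra and let $\mathcal{X}$ be a contravariantly finite subcategory of $\mathrm{mod}\text{-}\Lambda$ such that $\mathrm{prj}\text{-}\Lambda\subseteq\mathcal{X}\subseteq{}^{\perp}\Lambda$. Assume further that $\mathcal{X}=\mathrm{add}(X)$ is of finite type. Set $\Gamma=\mathrm{Aus}(\mathcal{X})=\mathrm{End}_\Lambda(X)$ and let $T=\zeta^{\mathcal{X}}_{X}(X)$, regarded as a right $\Gamma$-module. Then: (i) If $\mathcal{X}$ is closed under syzygies, then $T$ is a tilting module over $\Gamma$. (ii) If, furthermore, $\mathcal{X}$ is closed under submodules, then $T$ is a cotilting module over $\Gamma$.
   Context: $\mathrm{mod}\text{-}\Lambda$ is the category of finitely generated right $\Lambda$-modules and $\mathrm{prj}\text{-}\Lambda$ its subcategory of finitely generated projectives. Subcategories are full and closed under isomorphisms and finite direct sums. ${}^{\perp}\Lambda=\{M\in\mathrm{mod}\text{-}\Lambda : \mathrm{Ext}^i_\Lambda(M,\Lambda)=0 \text{ for all } i\ge 1\}$. $\mathrm{add}(X)$ is the class of direct summands of finite direct sums of copies of $X$; $\mathcal{X}$ is of finite type if it has only finitely many indecomposables up to isomorphism; $X$ with $\mathcal{X}=\mathrm{add}(X)$ is called an additive generator. $\mathcal{X}$ is closed under syzygies if for $M\in\mathcal{X}$ and any short exact sequence $0\to\Omega(M)\to P\to M\to 0$ in $\mathrm{mod}\text{-}\Lambda$ with $P$ projective, $\Omega(M)\in\mathcal{X}$. Functor category. $\mathrm{mod}\text{-}\mathcal{X}$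 is the abelian category of finitely presented contravariant additive functors $F:\mathcal{X}\to\mathcal{A}b$ (abelian groups), i.e. those admitting an exact sequence $\mathcal{X}(-,X_1)\to\mathcal{X}(-,X_0)\to F\to 0$ with $X_0,X_1\in\mathcal{X}$. The exact functor $\vartheta:\mathrm{mod}\text{-}\mathcal{X}\to\mathrm{mod}\text{-}\Lambda$ sends such an $F$, with presentation induced by $d:X_1\to X_0$, to $\mathrm{Coker}(d)$. It has a left adjoint $\vartheta_\lambda$, given by $\vartheta_\lambda(M)=\mathrm{Coker}(\mathcal{X}(-,P)\to\mathcal{X}(-,Q))$ for a projective presentation $P\to Q\to M\to 0$ in $\mathrm{mod}\text{-}\Lambda$, and a right adjoint $\vartheta_\rho$, given by $\vartheta_\rho(M)=\mathrm{Hom}_\Lambda(-,M)|_{\mathcal{X}}$; the counit $\vartheta\vartheta_\rho\to\mathrm{id}$ is an isomorphism. Let $\gamma_M:\vartheta_\lambda(M)\to\vartheta_\rho(M)$ be the map corresponding to the inverse of this counit under the adjunction $\mathrm{Hom}(\vartheta_\lambda(M),\vartheta_\rho(M))\cong\mathrm{Hom}_\Lambda(M,\vartheta\vartheta_\rho(M))$. The $\mathcal{X}$-intermediate extension functor is $\zeta^{\mathcal{X}}:\mathrm{mod}\text{-}\Lambda\to\mathrm{mod}\text{-}\mathcal{X}$, $\zeta^{\mathcal{X}}_M:=\mathrm{Im}(\gamma_M)$. Evaluation at $X$ is an equivalence $\mathrm{mod}\text{-}\mathcal{X}\to\mathrm{mod}\text{-}\mathrm{End}_\Lambda(X)$, $F\mapsto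 F(X)$; in particular $\zeta^{\mathcal{X}}_X(X)$ is the value of the functor $\zeta^{\mathcal{X}}_X$ at $X$, a right $\Gamma$-module. A module $T\in\mathrm{mod}\text{-}\Gamma$ is tilting if (a) its projective dimension is at most $1$; (b) $\mathrm{Ext}^1_\Gamma(T,T)=0$; (c) $T$ has $n$ indecomposable direct summands (up to isomorphism), where $n$ is the number of indecomposable direct summands (up to isomorphism) of $\Gamma$. It is cotilting if its injective dimension is at most $1$ and it satisfies (b) and (c). *)

(* Defs.v *)
From HB Require Import structures.
From mathcomp Require Import all_boot all_algebra.
From mathcomp Require Import boolp.

Set Implicit Arguments.
Unset Strict Implicit.
Unset Printing Implicit Defensive.

Import GRing.Theory.
Local Open Scope ring_scope.

(* Throughout, a right module over a ring A is a (left) module over the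
   converse ring A^c; modules over an arbitrary ring B are [lmodType B]. *)
Notation rmodType A := (lmodType A^c).

Notation rreg A := ((A^c)^o : rmodType A).


Section Hom.
Context {B : pzRingType}.
Implicit Types U V W : lmodType B.

Lemma linearext U V (f g : {linear U -> V}) : f =1 g -> f = g.
Proof.
case: f => f [[[f0 fD]] [fZ]]; case: g => g [[[g0 gD]] [gZ]] /= fg.
have {}fg : f = g by apply: funext.
subst g; congr GRing.Linear.Pack.
by rewrite (Prop_irrelevance f0 g0) (Prop_irrelevance fD gD)
  (Prop_irrelevance fZ gZ).
Qed.

HB.instance Definition _ U V := gen_eqMixin {linear U -> V}.
HB.instance Definition _ U V := gen_choiceMixin {linear U -> V}.

Section Zmod.
Variables U V : lmodType B.
Definition lin0 : {linear U -> V} := \0.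
Definition linN (f : {linear U -> V}) : {linear U -> V} := \- f.
Definition linD (f g : {linear U -> V}) : {linear U -> V} := f \+ g.
Fact linDA : associative linD.
Proof. by move=> f g h; apply: linearext => x /=; rewrite addrA. Qed.
Fact linDC : commutative linD.
Proof. by move=> f g; apply: linearext => x /=; rewrite addrC. Qed.
Fact lin0D : left_id lin0 linD.
Proof. by move=> f; apply: linearext => x /=; rewrite add0r. Qed.
Fact linND : left_inverse lin0 linN linD.
Proof. by move=> f; apply: linearext => x /=; rewrite addNr. Qed.
End Zmod.
HB.instance Definition _ U V :=
  GRing.isZmodule.Build {linear U -> V}
    (@linDA U V) (@linDC U V) (@lin0D U V) (@linND U V).

Lemma lin0E U V x : (0 : {linear U -> V}) x = 0. Proof. by []. Qed.
Lemma linDE U V (f g : {linear U -> V}) x : (f + g) x = f x + g x.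
Proof. by []. Qed.
Lemma linNE U V (f : {linear U -> V}) x : (- f) x = - f x. Proof. by []. Qed.
Lemma linBE U V (f g : {linear U -> V}) x : (f - g) x = f x - g x.
Proof. by []. Qed.

Definition lid U : {linear U -> U} := idfun.
Definition lcomp U V W (f : {linear V -> W}) (g : {linear U -> V}) :
  {linear U -> W} := f \o g.

Definition mklin U V (f : U -> V) (fP : linear f) : {linear U -> V} :=
  HB.pack f (GRing.isLinear.Build B U V *:%R f fP).

End Hom.

Definition endo (B : pzRingType) (U : lmodType B) := {linear U -> U}.

Section Endo.
Context (B : pzRingType) (U : lmodType B).
HB.instance Definition _ := GRing.Zmodule.on (endo U).
Definition emul (f g : endo U) : endo U := lcomp f g.
Fact emulA : associative emul.
Proof. by move=> f g h; apply: linearext. Qed.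
Fact emul1l : left_id (lid U : endo U) emul.
Proof. by move=> f; apply: linearext. Qed.
Fact emul1r : right_id (lid U : endo U) emul.
Proof. by move=> f; apply: linearext. Qed.
Fact emulDl : left_distributive emul +%R.
Proof. by move=> f g h; apply: linearext. Qed.
Fact emulDr : right_distributive emul +%R.
Proof. by move=> f g h; apply: linearext => x /=; rewrite raddfD. Qed.
HB.instance Definition _ :=
  GRing.Zmodule_isPzRing.Build (endo U) emulA emul1l emul1r emulDl emulDr.
End Endo.



Section Modules.
Context {B : pzRingType}.
Implicit Types U V W P I : lmodType B.

Definition submodule V (S : V -> Prop) :=
  S 0 /\ forall a u v, S u -> S v -> S (a *: u + v).

Definition span V (s : seq V) (v : V) :=
  exists c : nat -> B, v = \sum_(i < size s) c i *: s`_i.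

Definition fin_gen V := exists s : seq V, forall v, span s v.

Definition surjective (aT rT : Type) (f : aT -> rT) :=
  forall y, exists x, f x = y.

Definition exact_at U V W (f : U -> V) (g : V -> W) :=
  forall v, g v = 0 <-> exists u, f u = v.

Definition isomorphic U V := exists f : {linear U -> V}, bijective f.

Definition zero_module V := forall v : V, v = 0.

Definition projective P :=
  forall U V (g : {linear U -> V}) (f : {linear P -> V}),
    surjective g -> exists h : {linear P -> U}, g \o h =1 f.

Definition injective_module I :=
  forall U V (g : {linear U -> V}) (f : {linear U -> I}),
    injective g -> exists h : {linear V -> I}, h \o g =1 f.

Definition summand U V := exists W : lmodType B, isomorphic V (U * W)%type.

Definition indecomposable U :=
  ~ zero_module U /\
  forall V W, isomorphic U (V * W)%type -> zero_module V \/ zero_module W.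

(* U has, up to isomorphism, exactly n indecomposable direct summands. *)
Definition num_indec_summands U (n : nat) :=
  exists S : 'I_n -> lmodType B,
    [/\ forall i, indecomposable (S i) /\ summand (S i) U,
        forall i j, isomorphic (S i) (S j) -> i = j
      & forall V, indecomposable V -> summand V U ->
          exists i, isomorphic V (S i)].

Definition proj_resolution U (P : nat -> lmodType B)
    (d : forall n, {linear P n.+1 -> P n}) (e : {linear P 0 -> U}) :=
  [/\ forall n, projective (P n), surjective e, exact_at (d 0) e
    & forall n, exact_at (d n.+1) (d n)].

(* Ext^(n+1)(U, V) = 0: in degree n+1, every cocycle of the complex Hom(P, V)
   is a coboundary. As Ext does not depend on the projective resolution P of U,
   quantifying over all of them is harmless. *)
Definition ext_succ_eq0 (n : nat) U V :=
  forall (P : nat -> lmodType B) (d : forall n, {linear P n.+1 -> P n})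
      (e : {linear P 0 -> U}),
    proj_resolution d e ->
    forall f : {linear P n.+1 -> V}, f \o d n.+1 =1 \0 ->
      exists g : {linear P n -> V}, g \o d n =1 f.

(* Resolutions by arbitrary modules. Over an artin algebra, a finitely generated
   module has the same projective and injective dimensions in mod-B. *)
Definition proj_dim_le1 U :=
  exists (P1 P0 : lmodType B) (d : {linear P1 -> P0}) (e : {linear P0 -> U}),
    [/\ projective P1, projective P0, injective d, exact_at d e & surjective e].

Definition inj_dim_le1 U :=
  exists (I0 I1 : lmodType B) (e : {linear U -> I0}) (d : {linear I0 -> I1}),
    [/\ injective_module I0, injective_module I1, injective e, exact_at e d
      & surjective d].

End Modules.

Definition tilting (A : pzRingType) (T : rmodType A) :=
  [/\ fin_gen T, proj_dim_le1 T, ext_succ_eq0 0 T T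
    & exists n, num_indec_summands T n /\ num_indec_summands (rreg A) n].

Definition cotilting (A : pzRingType) (T : rmodType A) :=
  [/\ fin_gen T, inj_dim_le1 T, ext_succ_eq0 0 T T
    & exists n, num_indec_summands T n /\ num_indec_summands (rreg A) n].


Definition artinian (R : comPzRingType) :=
  forall I : nat -> R^o -> Prop,
    (forall n, submodule (I n)) -> (forall n r, I n.+1 r -> I n r) ->
    exists n, forall m r, (n <= m)%N -> I n r -> I m r.

Definition artin_algebra (R : comPzRingType) (L : algType R) :=
  artinian R /\ fin_gen (L : lmodType R).


(* A full subcategory of the category of finitely generated B-modules, closed
   under isomorphisms and finite direct sums. *)
Record subcat (B : pzRingType) := Subcat {
  in_subcat :> lmodType B -> Prop;
  subcat_fg : forall U, in_subcat U -> fin_gen U;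
  subcat_iso : forall U V, isomorphic U V -> in_subcat U -> in_subcat V;
  subcat0 : forall U, zero_module U -> in_subcat U;
  subcatD : forall U V, in_subcat U -> in_subcat V -> in_subcat (U * V)%type }.

Record obj (B : pzRingType) (C : subcat B) := Obj {
  omod :> lmodType B;
  omodP : C omod }.


Definition noetherian (B : pzRingType) :=
  forall (U V : lmodType B) (i : {linear U -> V}),
    injective i -> fin_gen V -> fin_gen U.

Section Span.
Context {B : pzRingType}.
Implicit Types U V W : lmodType B.

Lemma submD V (S : V -> Prop) u v : submodule S -> S u -> S v -> S (u + v).
Proof. by move=> [_ H] Su Sv; rewrite -[u]scale1r; apply: H. Qed.
Lemma submZ V (S : V -> Prop) a v : submodule S -> S v -> S (a *: v).
Proof. by move=> [S0 H] Sv; rewrite -[_ *: _]addr0; apply: H. Qed.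
Lemma submB V (S : V -> Prop) u v : submodule S -> S u -> S v -> S (u - v).
Proof.
by move=> HS Su Sv; rewrite -scaleN1r addrC; apply: HS.2.
Qed.

Lemma span_submodule V (s : seq V) : submodule (span s).
Proof.
split=> [|a u v [c ->] [d ->]].
  by exists (fun=> 0); rewrite big1 // => i _; rewrite scale0r.
exists (fun i => a * c i + d i).
rewrite scaler_sumr -big_split; apply: eq_bigr => i _ /=.
by rewrite scalerDl scalerA.
Qed.

Lemma span_nil V (v : V) : span [::] v <-> v = 0.
Proof.
split=> [[c ->]|->]; first by rewrite big_ord0.
exact: (span_submodule [::]).1.
Qed.

Lemma span_cons V (u : V) s v :
  span (u :: s) v <-> exists a w, span s w /\ v = a *: u + w.
Proof.
split=> [[c ->]|[a [_ [[c ->] ->]]]].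
  exists (c 0), (\sum_(i < size s) c i.+1 *: s`_i); split.
    by exists (fun i => c i.+1).
  by rewrite /= big_ord_recl.
by exists (fun i => if i is j.+1 then c j else a); rewrite /= big_ord_recl.
Qed.

Lemma mem_span V (s : seq V) v : v \in s -> span s v.
Proof.
elim: s => // u s IHs; rewrite inE => /orP[/eqP ->|/IHs sv]; apply/span_cons.
  exists 1, 0; split; first exact: (span_submodule s).1.
  by rewrite scale1r addr0.
by exists 0, v; rewrite scale0r add0r.
Qed.

Lemma span_min V (S : V -> Prop) (s : seq V) v :
  submodule S -> (forall u, u \in s -> S u) -> span s v -> S v.
Proof.
move=> HS; elim: s v => [|u s IHs] v sS.
  by move/span_nil->; exact: HS.1.
move/span_cons=> [a [w [sw ->]]]; apply: submD => //.
  by apply: submZ => //; apply: sS; rewrite mem_head.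
by apply: IHs => // u' su'; apply: sS; rewrite inE su' orbT.
Qed.

Lemma span_sub V (s t : seq V) v :
  (forall u, u \in s -> span t u) -> span s v -> span t v.
Proof. by apply: span_min; apply: span_submodule. Qed.

Lemma submodule_preim U V (f : {linear U -> V}) (S : V -> Prop) :
  submodule S -> submodule (fun u => S (f u)).
Proof.
by move=> [S0 SP]; split=> [|a u v Su Sv]; rewrite ?linear0 ?linearP //; apply: SP.
Qed.

Lemma submodule_im U V (f : {linear U -> V}) (S : U -> Prop) :
  submodule S -> submodule (fun v => exists u, S u /\ f u = v).
Proof.
move=> [S0 SP]; split=> [|a _ _ [u [Su <-]] [v [Sv <-]]].
  by exists 0; rewrite linear0.
by exists (a *: u + v); rewrite linearP; split=> //; apply: SP.
Qed.

Lemma submodule_full V : submodule (fun _ : V => True).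
Proof. by []. Qed.

Lemma submoduleI V (S T : V -> Prop) :
  submodule S -> submodule T -> submodule (fun v => S v /\ T v).
Proof.
move=> [S0 SP] [T0 TP]; split=> // a u v [Su Tu] [Sv Tv].
by split; [apply: SP|apply: TP].
Qed.

Definition fg_sub V (S : V -> Prop) :=
  exists s : seq V, (forall v, v \in s -> S v) /\ forall v, S v -> span s v.

Lemma fin_gen_surj U V (f : {linear U -> V}) :
  surjective f -> fin_gen U -> fin_gen V.
Proof.
move=> sf [s sU]; exists (map f s) => v; have [u <-] := sf v.
apply: (span_min (submodule_preim f (span_submodule _)) _ (sU u)) => w sw.
by apply: mem_span; apply: map_f.
Qed.

Lemma lift_gens U V (f : {linear U -> V}) (S : U -> Prop) (s : seq V) :
  (forall v, v \in s -> exists u, S u /\ f u = v) ->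
  exists t : seq U, (forall u, u \in t -> S u) /\ s = map f t.
Proof.
elim: s => [|v s IHs] Hs; first by exists [::].
have [u [Su fu]] := Hs v (mem_head _ _).
case: IHs => [w sw|t [tS ->]]; first by apply: Hs; rewrite inE sw orbT.
exists (u :: t); rewrite /= fu; split=> // w.
by rewrite inE => /orP[/eqP ->|/tS].
Qed.

Lemma span_map U V (f : {linear U -> V}) (s : seq U) v :
  span (map f s) v <-> exists u, span s u /\ f u = v.
Proof.
split=> [|[u [su <-]]].
  apply: (@span_min V (fun v => exists u, span s u /\ f u = v)).
    exact: submodule_im (span_submodule s).
  by move=> _ /mapP[u su ->]; exists u; split=> //; apply: mem_span.
apply: (span_min (submodule_preim f (span_submodule _)) _ su) => w sw.
by apply: mem_span; apply: map_f.
Qed.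

Lemma fg_sub_ext U V (f : {linear U -> V}) (S : U -> Prop) :
  submodule S -> fg_sub (fun v => exists u, S u /\ f u = v) ->
  fg_sub (fun u => S u /\ f u = 0) -> fg_sub S.
Proof.
move=> HS [s [sS Ss]] [t [tS St]].
have [s' [s'S defs]] := lift_gens sS.
exists (s' ++ t); split=> [u|u Su].
  by rewrite mem_cat => /orP[/s'S|/tS[]].
have /Ss : exists u', S u' /\ f u' = f u by exists u.
rewrite defs => /span_map[w [s'w fw]].
have Sw : S w by exact: span_min s'S s'w.
rewrite -[u](addrNK w); apply: (submD (span_submodule _)).
  apply: (@span_sub _ t) => [x tx|]; first by apply: mem_span; rewrite mem_cat tx orbT.
  by apply: St; rewrite linearB fw subrr; split=> //; apply: submB.
apply: span_sub s'w => x sx; by apply: mem_span; rewrite mem_cat sx.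
Qed.

Lemma fin_gen_inj U V (i : {linear U -> V}) :
  injective i -> fg_sub (fun v => exists u, True /\ i u = v) -> fin_gen U.
Proof.
move=> inji [s [sS Ss]]; have [t [_ defs]] := lift_gens sS.
exists t => u; have /Ss : exists u', True /\ i u' = i u by exists u.
by rewrite defs => /span_map[w [tw /inji <-]].
Qed.

End Span.

Section ArtinianIdeals.
Variables (R : comPzRingType) (artR : artinian R).
Implicit Types (I J : R^o -> Prop).

Lemma min_ideal (P : (R^o -> Prop) -> Prop) :
  (forall I, P I -> submodule I) -> (exists I, P I) ->
  exists I, P I /\ forall J, P J -> (forall r, J r -> I r) -> forall r, I r -> J r.
Proof.
move=> subP [I0 PI0]; apply: contrapT => noI.
have next (I : {I | P I}) : exists J : {I | P I},
    (forall r, sval J r -> sval I r) /\ ~ (forall r, sval I r -> sval J r).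
  apply: contrapT => noJ; apply: noI; exists (sval I); split; first exact: svalP.
  move=> J PJ JI; apply: contrapT => nIJ.
  by apply: noJ; exists (exist _ J PJ).
have [g Hg] := choice next.
pose I n := iter n g (exist _ I0 PI0).
have [n|n r|n Hn] := artR (I := fun n => sval (I n)).
- exact/subP/svalP.
- exact: (Hg (I n)).1.
- by apply: (Hg (I n)).2 => r; apply: (Hn n.+1 r (leqnSn n)).
Qed.

Lemma artinian_mul_stable (x : R) :
  exists n y, x ^+ n = x ^+ n.+1 * y.
Proof.
have [n|n r [y ->]|n Hn] := artR (I := fun n r => exists y, r = x ^+ n * y).
- split=> [|a _ _ [u ->] [v ->]]; first by exists 0; rewrite mulr0.
  by exists (a * u + v); rewrite mulrDr -[a *: _]/(a * _) mulrCA.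
- by exists (x * y); rewrite mulrA -exprSr.
- have [|y Hy] := Hn n.+1 (x ^+ n) (leqnSn n); first by exists 1; rewrite mulr1.
  by exists n, y.
Qed.

Fact mulx_linear (x : R) : linear ( *%R x : R^o -> R^o).
Proof. by move=> a u v; rewrite mulrDr -[a *: u]/(a * u) mulrCA. Qed.
Let mulx (x : R) : {linear R^o -> R^o} := mklin (mulx_linear x).

Section MinimalIdeal.
Variable I : R^o -> Prop.
Hypotheses (subI : submodule I) (nfgI : ~ fg_sub I).
Hypothesis minI : forall J, submodule J -> ~ fg_sub J ->
  (forall r, J r -> I r) -> forall r, I r -> J r.


Lemma min_ideal_div (x : R) :
  (forall r, I r -> x * r = 0) \/
  (exists y, forall r, I r -> y * x * r = r).
Proof.
pose J (r : R^o) := exists u, I u /\ mulx x u = r.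
pose K (r : R^o) := I r /\ mulx x r = 0.
have subJ : submodule J by exact: submodule_im.
have subK : submodule K.
  split=> [|a u v [Iu Ku] [Iv Kv]]; first by split; [case: subI|apply: mulr0].
  by split; [apply: subI.2|rewrite linearP Ku Kv scaler0 addr0].
have [fgK|nfgK] := pselect (fg_sub K); last first.
  by left=> r Ir; have [] : K r by apply: minI Ir => // ? [].
have nfgJ : ~ fg_sub J by move=> fgJ; apply/nfgI/(fg_sub_ext subI fgJ fgK).
have IJ : forall r, I r -> J r.
  by apply: minI => // _ [u [Iu <-]]; exact: (@submZ _ R^o I x u).
right; have [n [y xy]] := artinian_mul_stable x; exists y => r Ir.
have [u [_ <-]] : exists u, I u /\ x ^+ n * u = r.
  elim: {xy} n r Ir => [|n IHn] r Ir; first by exists r; rewrite mul1r.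
  have [u [/IHn[w [Iw <-]] <-]] := IJ r Ir.
  by exists w; rewrite /= mulrA exprS.
by rewrite {2}xy !mulrA; congr (_ * _); rewrite -mulrA -exprS mulrC.
Qed.

Lemma min_ideal_absurd : False.
Proof.
have next (s : seq R^o) : exists x, (forall r, r \in s -> I r) -> I x /\ ~ span s x.
  have [sI|] := pselect (forall r, r \in s -> I r); last by exists 0.
  apply: contrapT => nx; apply: nfgI; exists s; split=> // v Iv.
  by apply: contrapT => nsv; apply: nx; exists v.
have [g Hg] := choice next.
pose s n := iter n (fun s => g s :: s) [::].
have sI n r : r \in s n -> I r.
  elim: n r => [|n IHn] r //=; rewrite inE => /orP[/eqP ->|/IHn //].
  by apply: (Hg (s n) _).1.
pose v n := g (s n).
have vI n : I (v n) by exact: (Hg _ (@sI n)).1.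
have nv n : ~ span (s n) (v n) by exact: (Hg _ (@sI n)).2.
pose W n (r : R^o) := forall S : R^o -> Prop,
  submodule S -> (forall i, (n <= i)%N -> S (v i)) -> S r.
have subW n : submodule (W n).
  split=> [S [] //|a x y Wx Wy S HS Sv].
  by apply: HS.2; [apply: Wx|apply: Wy].
have [n|n r Wr S HS Sv|n /(_ n.+1 (v n) (leqnSn n)) Hn] := artR (I := W).
- exact: subW.
- by apply: Wr => // i /ltnW; apply: Sv.
have {}Hn : W n.+1 (v n) by apply: Hn => S _; apply.
have vs i m : (i < m)%N -> v i \in s m.
  elim: m => // m IHm; rewrite ltnS leq_eqVlt inE => /orP[/eqP ->|/IHm ->].
    by rewrite eqxx.
  by rewrite orbT.
pose t k := iteri k (fun j l => v (n.+1 + j)%N :: l) [::].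
have ts k r : r \in t k -> r \in s (n.+1 + k)%N.
  elim: k r => [|k IHk] r; first by [].
  rewrite addnS [t _]/= inE => /orP[/eqP ->|/IHk sr]; first exact: vs.
  by rewrite [s _]/= inE sr orbT.
have t_mono k l r : (k <= l)%N -> span (t k) r -> span (t l) r.
  move=> /subnK <-; elim: (l - k)%N => [|j IHj] // /IHj.
  by move=> tr; apply/span_cons; exists 0, r; rewrite scale0r add0r.
have [|i ni|k] := Hn (fun r => exists k, span (t k) r).
- split=> [|a x y [k tx] [l ty]]; first by exists 0; apply/span_nil.
  exists (maxn k l); apply: (span_submodule _).2.
    exact: t_mono (leq_maxl _ _) tx.
  exact: t_mono (leq_maxr _ _) ty.
- by exists (i - n.+1).+1; apply: mem_span; rewrite /= subnKC // mem_head.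
elim: k => [|k IHk].
  by move/span_nil=> vn0; apply: (nv n); rewrite vn0; exact: (span_submodule _).1.
move=> /span_cons[a [w [tw Dvn]]].
have [a0|[b ba]] := min_ideal_div a.
  by apply: IHk; rewrite Dvn [a *: _]a0 // add0r.
have w_s : span (s (n.+1 + k)%N) w.
  by apply: span_sub tw => r /ts; apply: mem_span.
apply: (nv (n.+1 + k)%N); rewrite -[v _]ba // -mulrA.
apply: (submZ (V := R^o)); first exact: span_submodule.
rewrite -[a * _](addrK w) -[a * _ + w]Dvn.
apply: submB => //; first exact: span_submodule.
by apply: mem_span; apply: vs; rewrite addSn ltnS leq_addr.
Qed.
End MinimalIdeal.

Lemma ideal_fg (I : R^o -> Prop) : submodule I -> fg_sub I.
Proof.
move=> subI; apply: contrapT => nfgI.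
have [|J [[subJ nfgJ] minJ]] :=
  @min_ideal (fun J => submodule J /\ ~ fg_sub J) (fun J => @proj1 _ _).
  by exists I.
by apply: (min_ideal_absurd subJ nfgJ) => K subK nfgK; apply: minJ.
Qed.

Lemma artinian_fg_sub (V : lmodType R) (S : V -> Prop) (s : seq V) :
  submodule S -> (forall v, S v -> span s v) -> fg_sub S.
Proof.
elim: s S => [|x s IHs] S subS Ss.
  by exists [::].
pose J (r : R^o) := exists w, span s w /\ S (r *: x + w).
have subJ : submodule J.
  split=> [|a b c [w [sw Sw]] [w' [sw' Sw']]].
    by exists 0; rewrite scale0r addr0; split; [exact: (span_submodule s).1|exact: subS.1].
  exists (a *: w + w'); split; first exact: (span_submodule s).2.
  rewrite scalerDl -scalerA addrACA -scalerDr; exact: subS.2.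
have [js [jsJ Jjs]] := ideal_fg subJ.
have [||t [tT Tt]] := IHs (fun v => S v /\ span s v).
- by apply: submoduleI => //; apply: span_submodule.
- by move=> v [].
have [us [usS Hus]] : exists us : seq V, (forall u, u \in us -> S u) /\
    forall j, j \in js -> exists u, span us u /\ span s (u - j *: x).
  elim: js jsJ {Jjs} => [|j js IHjs] jsJ; first by exists [::].
  have [w [sw Sw]] := jsJ j (mem_head _ _).
  case: IHjs => [r rj|us [usS Hus]]; first by apply: jsJ; rewrite inE rj orbT.
  exists (j *: x + w :: us); split=> [u|i].
    by rewrite inE => /orP[/eqP ->|/usS].
  rewrite inE => /orP[/eqP ->|/Hus[u [usu su]]].
    exists (j *: x + w); split; first exact/mem_span/mem_head.
    by rewrite addrC addKr.
  exists u; split=> //; apply/span_cons; exists 0, u.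
  by rewrite scale0r add0r.
exists (us ++ t); split=> [u|v Sv].
  by rewrite mem_cat => /orP[/usS|/tT[]].
have [r [w [sw Dv]]] := (span_cons _ _ _).1 (Ss v Sv).
have [u [usu su]] : exists u, span us u /\ span s (u - r *: x).
  have /Jjs : J r by exists w; rewrite -Dv.
  apply: (@span_min _ R^o (fun r => exists u, span us u /\ span s (u - r *: x))) => //.
  split=> [|a b c [y [uy sy]] [z [uz sz]]].
    exists 0; split; first exact: (span_submodule _).1.
    by rewrite scale0r subr0; exact: (span_submodule _).1.
  exists (a *: y + z); split; first exact: (span_submodule _).2.
  rewrite scalerDl -scalerA opprD addrACA -scalerBr; exact: (span_submodule _).2.
rewrite -[v](addrNK u); apply: submD; first exact: span_submodule.
  apply: (@span_sub _ _ t) => [y ty|].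
    by apply: mem_span; rewrite mem_cat ty orbT.
  apply: Tt; split.
    by apply: submB => //; apply: span_min usS usu.
  have -> : v - u = w - (u - r *: x) by rewrite Dv opprB addrA [w + _]addrC.
  by apply: submB => //; apply: span_submodule.
by apply: span_sub usu => y uy; apply: mem_span; rewrite mem_cat uy.
Qed.

End ArtinianIdeals.

Section ArtinAlgebra.
Variables (R : comPzRingType) (L : algType R).

(* Restriction of scalars of right modules along R -> L. *)
Definition restr (U : rmodType L) : Type := U.

Section Restr.
Variable U : rmodType L.
HB.instance Definition _ := GRing.Zmodule.on (restr U).
Definition restr_scale (r : R) (u : restr U) : restr U :=
  (r%:A : L^c) *: (u : U).
Fact restr_scaleA a b u : restr_scale a (restr_scale b u) = restr_scale (a * b) u.
Proof.
rewrite /restr_scale scalerA; congr (_ *: _).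
by rewrite -[LHS]/((b%:A : L) * a%:A) mulr_algl scalerA mulrC.
Qed.
Fact restr_scale1 : left_id 1 restr_scale.
Proof. by move=> u; rewrite /restr_scale scale1r [LHS]scale1r. Qed.
Fact restr_scaleDr : right_distributive restr_scale +%R.
Proof. by move=> a u v; rewrite /restr_scale [LHS]scalerDr. Qed.
Fact restr_scaleDl u : {morph restr_scale^~ u : a b / a + b}.
Proof. by move=> a b; rewrite /restr_scale scalerDl [LHS]scalerDl. Qed.
HB.instance Definition _ := GRing.Zmodule_isLmodule.Build R (restr U)
  restr_scaleA restr_scale1 restr_scaleDr restr_scaleDl.
End Restr.

Lemma restr_submodule (U : rmodType L) (S : U -> Prop) :
  submodule S -> submodule (V := restr U) S.
Proof. by move=> [S0 SP]; split=> // a u v Su Sv; apply: SP. Qed.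

Lemma fin_gen_restr (U : rmodType L) :
  fin_gen (L : lmodType R) -> fin_gen U -> fin_gen (restr U).
Proof.
move=> [l Ll] [s Us].
pose G : seq (restr U) := [seq ((a : L^c) *: u : U) | u <- s, a <- l].
have restrZ r (v : restr U) : r *: v = ((r%:A : L^c) *: (v : U)) by [].
have spanG : submodule (V := restr U) (span G) by exact: span_submodule.
have Gs (a : L^c) u : u \in s -> span G (a *: u : U).
  move=> su; apply: (@span_min _ _ (fun a : L => span G ((a : L^c) *: u : U)) l)
    (Ll a) => [|b lb]; last by apply: mem_span; apply: allpairs_f.
  split=> [|r b c Gb Gc]; first by rewrite scale0r; exact: spanG.1.
  have -> : ((r *: b + c : L) : L^c) *: u = (r%:A : L^c) *: ((b : L^c) *: u) + (c : L^c) *: u.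
    rewrite scalerA -scalerDl; congr (_ *: _); congr (_ + _).
    by rewrite -[RHS]/((b : L) * r%:A) mulr_algr.
  exact: spanG.2 r _ _ Gb Gc.
exists G => u; apply: (@span_min _ U (span G) s) (Us u) => [|v sv]; last first.
  by rewrite -[v]scale1r; apply: Gs.
split=> [|b v w Gv Gw]; first exact: spanG.1.
apply: (submD spanG) => //.
apply: (@span_min _ (restr U) (fun v => span G (b *: (v : U))) G) Gv => [|x].
  split=> [|r x y Gx Gy]; first by rewrite scaler0; exact: spanG.1.
  have -> : b *: (r *: x + y : U) = (r%:A : L^c) *: (b *: (x : U)) + b *: (y : U).
    rewrite [LHS]scalerDr restrZ !scalerA; congr (_ *: _ + _).
    by rewrite -[LHS]/((r%:A : L) * b) -[RHS]/((b : L) * r%:A) mulr_algl mulr_algr.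
  exact: spanG.2 r _ _ Gx Gy.
by case/allpairsP=> [[y a]] /= [sy la ->]; rewrite scalerA; apply: Gs.
Qed.

Lemma artin_noetherian : artin_algebra L -> noetherian L^c.
Proof.
move=> [artR fgL] U V i inji fgV.
have [s Vs] := fin_gen_restr fgL fgV.
pose S (v : restr V) := exists u, True /\ i u = v.
have [||t [tS St]] := @artinian_fg_sub R artR (restr V) S s.
- by apply/restr_submodule/submodule_im.
- by move=> v _; apply: Vs.
apply: fin_gen_inj inji _; exists t; split=> // v /St.
apply: (@span_min _ (restr V) (@span _ V t)) => [|u tu]; last exact: (@mem_span _ V t u tu).
by apply: (@restr_submodule V); apply: span_submodule.
Qed.

End ArtinAlgebra.


Definition mkadd (U V : zmodType) (f : U -> V) (fP : zmod_morphism f) :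
  {additive U -> V} := HB.pack f (GRing.isZmodMorphism.Build U V f fP).

Section AdditiveImage.
Variables (U V : zmodType) (f : {additive U -> V}).

Definition in_aim : {pred V} := fun v => `[< exists u, f u = v >].

Lemma in_aimP v : reflect (exists u, f u = v) (v \in in_aim).
Proof. exact: asboolP. Qed.

Fact in_aim_zmod : zmod_closed in_aim.
Proof.
split=> [|_ _ /in_aimP[u <-] /in_aimP[v <-]]; apply/in_aimP.
  by exists 0; rewrite raddf0.
by exists (u - v); rewrite raddfB.
Qed.
HB.instance Definition _ := GRing.isZmodClosed.Build V in_aim in_aim_zmod.

Definition aim := {v : V | v \in in_aim}.
HB.instance Definition _ := [isSub of aim for @sval _ _].
HB.instance Definition _ := [Choice of aim by <:].
HB.instance Definition _ := [SubChoice_isSubZmodule of aim by <:].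

Definition acoker := Quotient.quot in_aim.
HB.instance Definition _ := GRing.Zmodule.on acoker.

Definition apr_fun (v : V) : acoker := (\pi_(Quotient.quot in_aim) v)%qT.
Fact apr_zmod : zmod_morphism apr_fun.
Proof. by move=> x y; rewrite /apr_fun raddfB. Qed.
Definition apr : {additive V -> acoker} := mkadd apr_zmod.

Lemma apr_surj : surjective apr.
Proof. by move=> q; exists (repr q); apply: reprK. Qed.

Lemma apr_eq0 v : apr v = 0 <-> exists u, f u = v.
Proof.
rewrite -(raddf0 apr) -(subr0 v) (rwP (in_aimP _)) Quotient.idealrBE subr0.
by split=> [/eqP|/eqP].
Qed.

End AdditiveImage.

Section LinearKernel.
Context {B : pzRingType} (U V : lmodType B) (f : {linear U -> V}).

Definition in_lker : {pred U} := fun u => f u == 0.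
Fact in_lker_submod : submod_closed in_lker.
Proof.
split=> [|a u v]; rewrite !unfold_in ?linear0 // => /eqP fu /eqP fv.
by rewrite linearP fu fv scaler0 addr0.
Qed.
HB.instance Definition _ := GRing.isSubmodClosed.Build B U in_lker in_lker_submod.

Definition lker := {u : U | u \in in_lker}.
HB.instance Definition _ := [isSub of lker for @sval _ _].
HB.instance Definition _ := [Choice of lker by <:].
HB.instance Definition _ := [SubChoice_isSubLmodule of lker by <:].

Definition kincl : {linear lker -> U} := \val.

Lemma kincl_inj : injective kincl. Proof. exact: val_inj. Qed.

Lemma kincl_exact : exact_at kincl f.
Proof.
move=> u; split=> [/eqP fu|[[v fv] <-]]; last exact/eqP.
by exists (exist _ u fu).
Qed.

Lemma kincl_lift (W : lmodType B) (g : {linear W -> U}) :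
  (forall w, f (g w) = 0) -> {h : {linear W -> lker} | lcomp kincl h = g}.
Proof.
move=> fg0; have kg w : g w \in in_lker by apply/eqP.
pose h w : lker := Sub (g w) (kg w).
have hP : linear h by move=> a u v; apply: val_inj; rewrite /= linearP.
by exists (mklin hP); apply: linearext.
Qed.

End LinearKernel.

Section LinearCokernel.
Context {B : pzRingType} (U V : lmodType B) (f : {linear U -> V}).

Definition lcoker : Type := acoker f.
HB.instance Definition _ := GRing.Zmodule.on lcoker.
Let pr : V -> lcoker := apr f.

Fact pr_surj : surjective pr. Proof. exact: apr_surj. Qed.

Definition coker_scale (a : B) (q : lcoker) : lcoker := pr (a *: repr q).
Fact coker_scale_pr a v : coker_scale a (pr v) = pr (a *: v).
Proof.
apply/eqP; rewrite -subr_eq0 -[_ - _](raddfB (apr f)) -scalerBr.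
have [u fu] : exists u, f u = repr (pr v) - v.
  by apply/apr_eq0; rewrite raddfB; apply/eqP; rewrite subr_eq0; apply/eqP/reprK.
by apply/eqP/apr_eq0; exists (a *: u); rewrite -fu; exact: (linearZ_LR f).
Qed.
Fact coker_scaleA a b q :
  coker_scale a (coker_scale b q) = coker_scale (a * b) q.
Proof.
by have [v <-] := pr_surj q; rewrite !coker_scale_pr scalerA.
Qed.
Fact coker_scale1 : left_id 1 coker_scale.
Proof. by move=> q; have [v <-] := pr_surj q; rewrite coker_scale_pr scale1r. Qed.
Fact coker_scaleDr : right_distributive coker_scale +%R.
Proof.
move=> a q r; have [v <-] := pr_surj q; have [w <-] := pr_surj r.
by rewrite -[_ + _](raddfD (apr f)) !coker_scale_pr -[RHS](raddfD (apr f)) -scalerDr.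
Qed.
Fact coker_scaleDl q : {morph coker_scale^~ q : a b / a + b}.
Proof.
move=> a b; have [v <-] := pr_surj q.
by rewrite !coker_scale_pr -[RHS](raddfD (apr f)) -scalerDl.
Qed.
HB.instance Definition _ := GRing.Zmodule_isLmodule.Build B lcoker
  coker_scaleA coker_scale1 coker_scaleDr coker_scaleDl.

Fact cpr_linear : linear pr.
Proof.
move=> a u v; rewrite [LHS](raddfD (apr f)); congr (_ + _).
by rewrite -[RHS]/(coker_scale a (pr u)) coker_scale_pr.
Qed.
Definition cpr : {linear V -> lcoker} := mklin cpr_linear.

Lemma cpr_surj : surjective cpr. Proof. exact: apr_surj. Qed.

Lemma cpr_exact : exact_at f cpr. Proof. exact: apr_eq0. Qed.

End LinearCokernel.

Lemma afactor (U V W : zmodType) (p : {additive U -> V}) (g : {additive U -> W}) :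
  surjective p -> (forall u, p u = 0 -> g u = 0) ->
  {h : {additive V -> W} | forall u, h (p u) = g u}.
Proof.
move=> sp pg; pose h v := g (sval (cid (sp v))).
have hp u : h (p u) = g u.
  rewrite /h; case: cid => w /= pw; apply/eqP.
  by rewrite -subr_eq0 -raddfB pg // raddfB pw subrr.
have hP : zmod_morphism h.
  by move=> x y; have [u <-] := sp x; have [v <-] := sp y; rewrite -raddfB !hp raddfB.
by exists (mkadd hP).
Qed.

Section Factor.
Context {B : pzRingType}.

Lemma lfactor (U V W : lmodType B) (p : {linear U -> V}) (g : {linear U -> W}) :
  surjective p -> (forall u, p u = 0 -> g u = 0) ->
  {h : {linear V -> W} | forall u, h (p u) = g u}.
Proof.
move=> sp pg; have [h hp] := afactor sp pg.
have hP : linear h.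
  move=> a x y; have [u <-] := sp x; have [v <-] := sp y.
  have hpE w : h (p w) = g w := hp w.
  by rewrite -linearP !hpE linearP.
by exists (mklin hP).
Qed.

Lemma proj_lift (P U V : lmodType B) (g : {linear U -> V}) (f : {linear P -> V}) :
  projective P -> surjective g -> exists h : {linear P -> U}, lcomp g h = f.
Proof.
by move=> PP sg; have [h gh] := PP _ _ g f sg; exists h; apply: linearext.
Qed.

(* Lifting along the corestriction U -> ker w of an exact pair. *)
Lemma proj_lift_exact (P U V W : lmodType B) (g : {linear U -> V})
    (w : {linear V -> W}) (f : {linear P -> V}) :
  projective P -> exact_at g w -> (forall x, w (f x) = 0) ->
  exists h : {linear P -> U}, lcomp g h = f.
Proof.
move=> PP gw wf0.
have [g' Dg'] : {g' : {linear U -> lker w} | lcomp (kincl w) g' = g}.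
  by apply: kincl_lift => u; apply/gw; exists u.
have [f' Df'] := kincl_lift wf0.
have [|h Dh] := proj_lift (g := g') f' PP.
  move=> [v wv]; have /gw[u gu] : w v = 0 by apply/eqP.
  by exists u; apply: val_inj; rewrite -[LHS]/(lcomp (kincl w) g' u) Dg'.
by exists h; rewrite -Dg' -Df' -Dh; apply: linearext.
Qed.

Lemma free_projective n : projective ('rV[B]_n : lmodType B).
Proof.
move=> U V g f sg.
have [s Hs] := choice (fun i : 'I_n => sg (f (delta_mx 0 i))).
pose h (c : 'rV[B]_n) := \sum_i c 0 i *: s i.
have hP : linear h.
  move=> a x y; rewrite /h scaler_sumr -big_split; apply: eq_bigr => i _ /=.
  by rewrite !mxE scalerDl scalerA.
exists (mklin hP) => c; rewrite /= [c in RHS]row_sum_delta !linear_sum.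
by apply: eq_bigr => i _; rewrite !linearZ Hs.
Qed.

Lemma free_fin_gen n : fin_gen ('rV[B]_n : lmodType B).
Proof.
exists [seq delta_mx 0 i | i <- enum 'I_n] => c; rewrite [c]row_sum_delta.
apply: (big_ind (span _)) => [|u v|i _].
- exact: (span_submodule _).1.
- by apply: submD; apply: span_submodule.
apply: submZ; first exact: span_submodule.
by apply: mem_span; apply: map_f; rewrite mem_enum.
Qed.

Lemma fin_gen_cover (V : lmodType B) : fin_gen V ->
  exists n (f : {linear 'rV[B]_n -> V}), surjective f.
Proof.
move=> [s Vs]; exists (size s).
pose h (c : 'rV[B]_(size s)) := \sum_i c 0 i *: s`_i.
have hP : linear h.
  move=> a x y; rewrite /h scaler_sumr -big_split; apply: eq_bigr => i _ /=.
  by rewrite !mxE scalerDl scalerA.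
exists (mklin hP) => v; have [c ->] := Vs v; exists (\row_i c i).
by apply: eq_bigr => i _; rewrite mxE.
Qed.

Lemma fin_genD (U V : lmodType B) : fin_gen U -> fin_gen V -> fin_gen (U * V)%type.
Proof.
move=> [s Us] [t Vt].
have iP : linear (fun u : U => (u, 0 : V)).
  by move=> a u v; rewrite -[LHS]/(a *: u + v, 0) -[RHS]/(a *: u + v, a *: 0 + 0) scaler0 addr0.
have jP : linear (fun v : V => (0 : U, v)).
  by move=> a u v; rewrite -[LHS]/(0, a *: u + v) -[RHS]/(a *: 0 + 0, a *: u + v) scaler0 addr0.
exists (map (mklin iP) s ++ map (mklin jP) t) => -[u v].
have -> : (u, v) = mklin iP u + mklin jP v.
  by rewrite -[RHS]/(u + 0, 0 + v) addr0 add0r.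
have subS := span_submodule (map (mklin iP) s ++ map (mklin jP) t).
apply: submD => //.
  apply: (span_min (submodule_preim (mklin iP) subS) _ (Us u)) => x sx.
  by apply: mem_span; rewrite mem_cat map_f.
apply: (span_min (submodule_preim (mklin jP) subS) _ (Vt v)) => x sx.
by apply: mem_span; rewrite mem_cat [X in _ || X]map_f ?orbT.
Qed.

Lemma fin_gen_iso (U V : lmodType B) : isomorphic U V -> fin_gen U -> fin_gen V.
Proof. by move=> [f [g _ fK]]; apply: (@fin_gen_surj _ _ _ f) => v; exists (g v). Qed.

Lemma fin_gen0 (U : lmodType B) : zero_module U -> fin_gen U.
Proof. by move=> U0; exists [::] => v; rewrite (U0 v); exact: (span_submodule _).1. Qed.

End Factor.


Local Obligation Tactic := idtac.

Section FunctorCategory.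
Context {B : pzRingType} {C : subcat B}.
Implicit Types X Y Z : obj C.

(* Contravariant additive functors from C to abelian groups; [modfunc] below
   is the type of objects of mod-C. *)
Record func := Func {
  fobj :> obj C -> zmodType;
  fmap : forall Y Z, {linear Y -> Z} -> {additive fobj Z -> fobj Y};
  fmap_id : forall Y (x : fobj Y), fmap (lid Y) x = x;
  fmap_comp : forall X Y Z (f : {linear Y -> Z}) (g : {linear X -> Y})
    (x : fobj Z), fmap (lcomp f g) x = fmap g (fmap f x);
  fmapD : forall Y Z (f g : {linear Y -> Z}) (x : fobj Z),
    fmap (f + g) x = fmap f x + fmap g x }.

Record nattrans (F G : func) := Nattrans {
  ntmap :> forall Y, {additive F Y -> G Y};
  ntnat : forall Y Z (f : {linear Y -> Z}) (x : F Z),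
    ntmap Y (fmap F f x) = fmap G f (ntmap Z x) }.

Definition nteq (F G : func) (a b : nattrans F G) :=
  forall Y (x : F Y), a Y x = b Y x.

Definition ntid (F : func) : nattrans F F :=
  @Nattrans F F (fun Y => idfun) (fun _ _ _ _ => erefl).

Program Definition ntcomp (F G H : func) (b : nattrans G H) (a : nattrans F G) :
  nattrans F H := @Nattrans F H (fun Y => b Y \o a Y) _.
Next Obligation. by move=> * /=; rewrite !ntnat. Qed.

Section HomFunctor.
Variable M : lmodType B.

Fact precomp_zmod Y Z (f : {linear Y -> Z}) :
  zmod_morphism (fun g : {linear Z -> M} => lcomp g f).
Proof. by move=> g h; apply: linearext. Qed.
Definition precomp Y Z (f : {linear Y -> Z}) :
  {additive {linear Z -> M} -> {linear Y -> M}} := mkadd (precomp_zmod f).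

(* Hom(-, M) restricted to C. *)
Program Definition homf : func :=
  @Func (fun Y => {linear Y -> M} : zmodType) precomp _ _ _.
Next Obligation. by move=> Y g; apply: linearext. Qed.
Next Obligation. by move=> X Y Z f g h; apply: linearext. Qed.
Next Obligation. by move=> Y Z f g h; apply: linearext => x /=; rewrite linearD. Qed.
End HomFunctor.

Lemma yoneda X (F : func) (p : nattrans (homf X) F) Y (f : {linear Y -> X}) :
  p Y f = fmap F f (p X (lid X)).
Proof. by rewrite -ntnat; congr (p Y _); apply: linearext. Qed.

(* C(-, X1) -> C(-, X0) -> F -> 0 exact, the first map being induced by
   pd : X1 -> X0. *)
Record presentation (F : func) := Presentation {
  pX1 : obj C;
  pX0 : obj C;
  pd : {linear pX1 -> pX0};
  pp : nattrans (homf pX0) F;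
  pp_surj : forall Y, surjective (pp Y);
  pp_exact : forall Y (f : {linear Y -> pX0}),
    pp Y f = 0 <-> exists g : {linear Y -> pX1}, lcomp pd g = f }.

Definition fin_presented (F : func) := inhabited (presentation F).

Record modfunc := Modfunc {
  mfun :> func;
  mfunP : fin_presented mfun }.

Lemma some_presentation (F : modfunc) : exists _ : presentation F, True.
Proof. by have [Q] := mfunP F; exists Q. Qed.

Definition pres (F : modfunc) : presentation F := sval (cid (some_presentation F)).

Section Image.
Variables (F G : func) (a : nattrans F G).

Fact im_fmap_subproof Y Z (f : {linear Y -> Z}) (x : aim (a Z)) :
  fmap G f (val x) \in in_aim (a Y).
Proof.
have /in_aimP[y ay] := valP x.
by apply/in_aimP; exists (fmap F f y); rewrite ntnat ay.
Qed.
Definition im_fmap_fun Y Z (f : {linear Y -> Z}) (x : aim (a Z)) : aim (a Y) :=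
  Sub (fmap G f (val x)) (im_fmap_subproof f x).
Fact im_fmap_zmod Y Z (f : {linear Y -> Z}) : zmod_morphism (im_fmap_fun f).
Proof. by move=> x y; apply: val_inj; rewrite /= !raddfB. Qed.

Program Definition imf : func :=
  @Func (fun Y => aim (a Y) : zmodType) (fun Y Z f => mkadd (im_fmap_zmod f)) _ _ _.
Next Obligation. by move=> Y x; apply: val_inj; rewrite /= fmap_id. Qed.
Next Obligation. by move=> X Y Z f g x; apply: val_inj; rewrite /= fmap_comp. Qed.
Next Obligation. by move=> Y Z f g x; apply: val_inj; rewrite /= fmapD. Qed.
End Image.

(* The cokernel of C(-, P) -> C(-, Q) induced by d : P -> Q. *)
Section CokernelFunctor.
Variables (P Q : lmodType B) (d : {linear P -> Q}).

Fact postcomp_zmod Y : zmod_morphism (fun g : {linear Y -> P} => lcomp d g).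
Proof. by move=> g h; apply: linearext => x /=; rewrite linearB. Qed.
Definition postcomp Y : {additive {linear Y -> P} -> {linear Y -> Q}} :=
  mkadd (@postcomp_zmod Y).

Definition cokf_map Y Z (f : {linear Y -> Z}) :
  {h : {additive acoker (postcomp Z) -> acoker (postcomp Y)}
   | forall g, h (apr (postcomp Z) g) = apr (postcomp Y) (lcomp g f)}.
Proof.
apply: (@afactor _ _ _ (apr (postcomp Z)) (apr (postcomp Y) \o precomp Q f)).
  exact: apr_surj.
move=> g /apr_eq0[h <-] /=; apply/apr_eq0; exists (lcomp h f).
exact: linearext.
Qed.

Program Definition cokf : func :=
  @Func (fun Y => acoker (postcomp Y) : zmodType)
    (fun Y Z f => sval (cokf_map f)) _ _ _.
Next Obligation.
move=> Y x; have [g <-] := apr_surj x; rewrite (svalP (cokf_map _)).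
by congr (apr _ _); apply: linearext.
Qed.
Next Obligation.
move=> X Y Z f g x; have [h <-] := apr_surj x.
rewrite !(svalP (cokf_map _)); congr (apr _ _); exact: linearext.
Qed.
Next Obligation.
move=> Y Z f g x; have [h <-] := apr_surj x.
rewrite !(svalP (cokf_map _)) -raddfD; congr (apr _ _).
by apply: linearext => y /=; rewrite linearD.
Qed.

Program Definition cokf_pr : nattrans (homf Q) cokf :=
  @Nattrans (homf Q) cokf (fun Y => apr (postcomp Y)) _.
Next Obligation. by move=> Y Z f x; rewrite (svalP (cokf_map _)). Qed.

End CokernelFunctor.

Program Definition cokf_pres X1 X0 (d : {linear X1 -> X0}) : presentation (cokf d) :=
  @Presentation (cokf d) X1 X0 d (cokf_pr d) _ _.
Next Obligation. by move=> X1 X0 d Y; apply: apr_surj. Qed.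
Next Obligation. by move=> X1 X0 d Y f; apply: apr_eq0. Qed.


(* The map Coker(d) -> Coker(d') induced by F -> G, for presentations of F and
   G induced by d and d'. *)
Lemma coker_map_subproof (F G : func) (Q : presentation F) (Q' : presentation G)
    (a : nattrans F G) :
  exists h : {linear lcoker (pd Q) -> lcoker (pd Q')},
    forall f : {linear pX0 Q -> pX0 Q'},
      pp Q' (pX0 Q) f = a _ (pp Q (pX0 Q) (lid _)) ->
      forall x, h (cpr (pd Q) x) = cpr (pd Q') (f x).
Proof.
have lift (f f' : {linear pX0 Q -> pX0 Q'}) : pp Q' (pX0 Q) f = a _ (pp Q (pX0 Q) (lid _)) ->
    pp Q' (pX0 Q) f' = a _ (pp Q (pX0 Q) (lid _)) ->
    forall x, cpr (pd Q') (f x) = cpr (pd Q') (f' x).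
  move=> Df Df' x; apply/eqP; rewrite -subr_eq0 -linearB; apply/eqP/cpr_exact.
  have /pp_exact[g Dg] : pp Q' (pX0 Q) (f - f') = 0.
    by rewrite raddfB [X in X - _]Df [X in _ - X]Df' subrr.
  by exists (g x); rewrite -[LHS]/(lcomp (pd Q') g x) Dg.
have [f Df] := pp_surj Q' (a _ (pp Q (pX0 Q) (lid _))).
have [|x /cpr_exact[y <-]|h Dh] :=
  @lfactor _ _ _ _ (cpr (pd Q)) (lcomp (cpr (pd Q')) f).
- exact: cpr_surj.
- apply/cpr_exact.
  have /pp_exact[g Dg] : pp Q' (pX1 Q) (lcomp f (pd Q)) = 0.
    rewrite yoneda fmap_comp -yoneda Df -ntnat -yoneda.
    suff -> : pp Q (pX1 Q) (pd Q) = 0 by rewrite raddf0.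
    by apply/pp_exact; exists (lid _); apply: linearext.
  by exists (g y); rewrite -[LHS]/(lcomp (pd Q') g y) Dg.
- by exists h => f' Df' x; rewrite Dh /=; apply: lift.
Qed.

Definition coker_map (F G : func) (Q : presentation F) (Q' : presentation G)
    (a : nattrans F G) : {linear lcoker (pd Q) -> lcoker (pd Q')} :=
  sval (cid (coker_map_subproof Q Q' a)).

Section CokerMap.
Implicit Types F G H : func.

Lemma coker_mapE F G (Q : presentation F) (Q' : presentation G)
    (a : nattrans F G) (f : {linear pX0 Q -> pX0 Q'}) :
  pp Q' (pX0 Q) f = a _ (pp Q (pX0 Q) (lid _)) ->
  forall x, coker_map Q Q' a (cpr (pd Q) x) = cpr (pd Q') (f x).
Proof. exact: (svalP (cid (coker_map_subproof Q Q' a))). Qed.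

Lemma coker_map_lift F G (Q : presentation F) (Q' : presentation G)
    (a : nattrans F G) :
  exists f : {linear pX0 Q -> pX0 Q'},
    pp Q' (pX0 Q) f = a _ (pp Q (pX0 Q) (lid _)).
Proof. exact: pp_surj. Qed.

Lemma coker_map_id F (Q : presentation F) : coker_map Q Q (ntid F) = lid _.
Proof.
apply: linearext => q; have [x <-] := cpr_surj q.
exact: (@coker_mapE _ _ _ _ _ (lid _)).
Qed.

Lemma coker_map_comp F G H (Q : presentation F) (Q' : presentation G)
    (Q'' : presentation H) (b : nattrans G H) (a : nattrans F G) :
  coker_map Q Q'' (ntcomp b a) = lcomp (coker_map Q' Q'' b) (coker_map Q Q' a).
Proof.
apply: linearext => q; have [x <-] := cpr_surj q.
have [f Df] := coker_map_lift Q Q' a; have [g Dg] := coker_map_lift Q' Q'' b.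
rewrite /= (coker_mapE Df) (coker_mapE Dg).
apply: (@coker_mapE _ _ _ _ _ (lcomp g f)).
by rewrite yoneda fmap_comp -yoneda Dg -ntnat -yoneda Df.
Qed.

Lemma eq_coker_map F G (Q : presentation F) (Q' : presentation G)
    (a b : nattrans F G) : nteq a b -> coker_map Q Q' a = coker_map Q Q' b.
Proof.
move=> ab; apply: linearext => q; have [x <-] := cpr_surj q.
have [f Df] := coker_map_lift Q Q' a.
rewrite (coker_mapE Df) (@coker_mapE _ _ _ _ b f) // Df; apply: ab.
Qed.

End CokerMap.

Lemma theta_fg (F : modfunc) : fin_gen (lcoker (pd (pres F))).
Proof.
apply: (@fin_gen_surj _ _ _ (cpr _)); first exact: cpr_surj.
exact: subcat_fg (omodP (pX0 (pres F))).
Qed.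
End FunctorCategory.
Arguments func {B} C.
Arguments modfunc {B} C.
Arguments homf {B} C M.
Arguments cokf {B} C {P Q} d.

Definition modcat (B : pzRingType) : subcat B :=
  @Subcat B (@fin_gen B) (fun _ => id) (@fin_gen_iso B) (@fin_gen0 B)
    (@fin_genD B).

Definition to_mod (B : pzRingType) (C : subcat B) (X : obj C) : obj (modcat B) :=
  @Obj B (modcat B) X (subcat_fg (omodP X)).

Section Theta.
Context {B : pzRingType} {C : subcat B}.

Definition theta (F : modfunc C) : obj (modcat B) :=
  @Obj B (modcat B) (lcoker (pd (pres F))) (theta_fg F).

Definition theta_map (F G : modfunc C) (a : nattrans F G) :
  {linear theta F -> theta G} := coker_map (pres F) (pres G) a.

Lemma theta_map_id (F : modfunc C) : theta_map (ntid F) = lid _.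
Proof. exact: coker_map_id. Qed.

Lemma theta_map_comp (F G H : modfunc C) (b : nattrans G H) (a : nattrans F G) :
  theta_map (ntcomp b a) = lcomp (theta_map b) (theta_map a).
Proof. exact: coker_map_comp. Qed.

(* theta sends F to Coker(d) for every presentation of F induced by d. *)
Lemma theta_coker (F : modfunc C) (Q : presentation F) :
  isomorphic (theta F) (lcoker (pd Q)).
Proof.
have e : nteq (ntcomp (ntid F) (ntid F)) (ntid F) by [].
exists (coker_map (pres F) Q (ntid F)).
exists (coker_map Q (pres F) (ntid F)) => x.
  rewrite -[LHS]/(lcomp _ (coker_map _ _ _) x) -coker_map_comp.
  by rewrite (eq_coker_map _ _ e) coker_map_id.
rewrite -[LHS]/(lcomp _ (coker_map _ _ _) x) -coker_map_comp.
by rewrite (eq_coker_map _ _ e) coker_map_id.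
Qed.

End Theta.


Definition contravariantly_finite (B : pzRingType) (C : subcat B) :=
  forall M : lmodType B, fin_gen M ->
    exists (Y : obj C) (f : {linear Y -> M}),
      forall (Z : obj C) (g : {linear Z -> M}),
        exists h : {linear Z -> Y}, f \o h =1 g.

Definition contains_projectives (B : pzRingType) (C : subcat B) :=
  forall P : lmodType B, fin_gen P -> projective P -> C P.

(* P -> Q -> M -> 0 in mod-B. *)
Record proj_presentation (B : pzRingType) (M : lmodType B) := ProjPresentation {
  qP : lmodType B;
  qQ : lmodType B;
  qP_fg : fin_gen qP;
  qQ_fg : fin_gen qQ;
  qP_proj : projective qP;
  qQ_proj : projective qQ;
  qd : {linear qP -> qQ};
  qe : {linear qQ -> M};
  q_exact : exact_at qd qe;
  q_surj : surjective qe }.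

Section IntermediateExtension.
Context {B : pzRingType} {C : subcat B}.
Hypothesis noethB : noetherian B.
Hypothesis cfC : contravariantly_finite C.
Hypothesis prjC : contains_projectives C.
Implicit Types M : obj (modcat B).

Lemma approx (M : lmodType B) : fin_gen M ->
  exists (Y : obj C) (f : {linear Y -> M}),
    forall (Z : obj C) (g : {linear Z -> M}),
      exists h : {linear Z -> Y}, lcomp f h = g.
Proof.
move=> /cfC[Y [f Hf]]; exists Y, f => Z g.
by have [h fh] := Hf Z g; exists h; apply: linearext.
Qed.

Lemma lker_fg (U V : lmodType B) (f : {linear U -> V}) :
  fin_gen U -> fin_gen (lker f).
Proof. by apply: noethB; apply: kincl_inj. Qed.

Definition free_obj : obj C := Obj (prjC (free_fin_gen 1) (@free_projective B 1)).

Lemma free_obj_elt (U : lmodType B) (u : U) :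
  exists f : {linear free_obj -> U}, f (const_mx 1) = u.
Proof.
have fP : linear (fun c : 'rV[B]_1 => c 0 0 *: u).
  by move=> a x y; rewrite !mxE scalerDl scalerA.
by exists (mklin fP); rewrite /= mxE scale1r.
Qed.

Lemma imf_fp (F G : func C) (a : nattrans F G) :
  fin_presented F -> fin_presented G -> fin_presented (imf a).
Proof.
move=> [Q] [Q']; have [f0 Df0] := coker_map_lift Q Q' a.
have aE (Y : obj C) (f : {linear Y -> pX0 Q}) : a Y (pp Q Y f) = pp Q' Y (lcomp f0 f).
  by rewrite [pp Q _ _]yoneda [pp Q' _ _]yoneda fmap_comp -[X in fmap G f X]yoneda Df0 ntnat.
have eP : linear (fun x : (pX0 Q * pX1 Q')%type => f0 x.1 - pd Q' x.2).
  move=> c x y; rewrite -[(c *: x + y).1]/(c *: x.1 + y.1).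
  rewrite -[(c *: x + y).2]/(c *: x.2 + y.2) (linearP f0) (linearP (pd Q')).
  by rewrite scalerBr opprD addrACA.
pose e : {linear (pX0 Q * pX1 Q')%type -> pX0 Q'} := mklin eP.
have fgE : fin_gen (lker e).
  by apply: lker_fg; apply: fin_genD; apply/subcat_fg/omodP.
have [W [w Hw]] := approx fgE.
have d1P : linear (fun x : (pX0 Q * pX1 Q')%type => x.1) by [].
have d2P : linear (fun x : (pX0 Q * pX1 Q')%type => x.2) by [].
pose d' : {linear W -> pX0 Q} := lcomp (mklin d1P) (lcomp (kincl e) w).
have imP (Y : obj C) (f : {linear Y -> pX0 Q}) : a Y (pp Q Y f) \in in_aim (a Y).
  by apply/in_aimP; exists (pp Q Y f).
pose p (Y : obj C) (f : {linear Y -> pX0 Q}) : aim (a Y) := Sub (a Y (pp Q Y f)) (imP Y f).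
have pP Y : zmod_morphism (p Y) by move=> f g; apply: val_inj; rewrite /= !raddfB.
have pN (Y Z : obj C) (f : {linear Y -> Z}) (x : homf C (pX0 Q) Z) :
    mkadd (pP Y) (fmap (homf C (pX0 Q)) f x) = fmap (imf a) f (mkadd (pP Z) x).
  by apply: val_inj; rewrite /= !ntnat.
constructor; apply: (@Presentation _ _ _ W (pX0 Q) d' (@Nattrans _ _ _ (imf a) _ pN)).
  move=> Y [x xim]; have /in_aimP[y Dy] := xim.
  have [f Df] := pp_surj Q y; exists f; apply: val_inj; rewrite /= -Dy.
  by congr (a Y _).
move=> Y f; split=> [pf0|[h <-]]; last first.
  apply: val_inj; rewrite /= aE; apply/pp_exact.
  exists (lcomp (mklin d2P) (lcomp (kincl e) (lcomp w h))); apply: linearext => y /=.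
  have /eqP := valP (w (h y)); rewrite /= => /eqP.
  by rewrite subr_eq0 => /eqP <-.
have {pf0} : a Y (pp Q Y f) = 0 by have := congr1 val pf0.
rewrite aE => /pp_exact[g Dg].
have fgP : linear (fun y : Y => (f y, g y)).
  by move=> c x y; rewrite !linearP.
have [|k Dk] := @kincl_lift _ _ _ e Y (mklin fgP).
  move=> y /=; rewrite -[pd _ _]/(lcomp (pd Q') g y) Dg; exact: subrr.
have [h Dh] := Hw Y k; exists h; apply: linearext => y /=.
by rewrite -[w (h y)]/(lcomp w h y) Dh -[sval _]/(lcomp (kincl e) k y) Dk.
Qed.

Lemma proj_presentation_exists M : exists _ : proj_presentation M, True.
Proof.
have [m [e se]] := fin_gen_cover (omodP M).
have [n [f sf]] := fin_gen_cover (lker_fg e (free_fin_gen m)).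
have ex : exact_at (lcomp (kincl e) f) e.
  move=> x; split=> [/kincl_exact[y <-]|[y <-]].
    by have [z <-] := sf y; exists z.
  by apply/kincl_exact; exists (f y).
by exists (ProjPresentation (free_fin_gen n) (free_fin_gen m)
  (@free_projective B n) (@free_projective B m) ex se).
Qed.

Definition ppres M : proj_presentation M := sval (cid (proj_presentation_exists M)).

(* theta_lambda(M) = Coker(C(-, P) -> C(-, Q)). *)
Definition lambda_pres M : presentation (cokf C (qd (ppres M))) :=
  @cokf_pres B C (Obj (prjC (qP_fg (ppres M)) (qP_proj (p := ppres M))))
    (Obj (prjC (qQ_fg (ppres M)) (qQ_proj (p := ppres M)))) (qd (ppres M)).

Definition theta_lambda M : modfunc C := Modfunc (inhabits (lambda_pres M)).

Lemma unit0_subproof M :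
  {h : {linear M -> lcoker (qd (ppres M))}
   | forall x, h (qe (ppres M) x) = cpr (qd (ppres M)) x}.
Proof.
apply: lfactor; first exact: q_surj.
by move=> x /q_exact[y <-]; apply/cpr_exact; exists y.
Qed.

(* The unit of the adjunction between theta_lambda and theta, namely the
   identification M = Coker(P -> Q) = theta(theta_lambda(M)). *)
Definition unit_lambda M : {linear M -> theta (theta_lambda M)} :=
  lcomp (coker_map (lambda_pres M) (pres (theta_lambda M)) (ntid _))
    (sval (unit0_subproof M)).

(* The adjunction Hom(theta_lambda(M), F) -> Hom(M, theta(F)), bijective by
   the two lemmas after the next one. *)
Definition adj_lambda M (F : modfunc C) (a : nattrans (theta_lambda M) F) :
  {linear M -> theta F} := lcomp (theta_map a) (unit_lambda M).

Lemma adj_lambdaE M (F : modfunc C) (a : nattrans (theta_lambda M) F)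
    (f : {linear pX0 (lambda_pres M) -> pX0 (pres F)}) :
  pp (pres F) (pX0 (lambda_pres M)) f = a _ (pp (lambda_pres M) _ (lid _)) ->
  forall x, adj_lambda a (qe (ppres M) x) = cpr (pd (pres F)) (f x).
Proof.
move=> Df x; rewrite /adj_lambda /unit_lambda /= (svalP (unit0_subproof M)).
rewrite /theta_map -[LHS]/(lcomp (coker_map _ _ a) (coker_map (lambda_pres M) _ _) _).
by rewrite -coker_map_comp (@coker_mapE _ _ _ _ _ _ _ f).
Qed.

Lemma adj_lambda_inj M (F : modfunc C) (a b : nattrans (theta_lambda M) F) :
  adj_lambda a =1 adj_lambda b -> nteq a b.
Proof.
move=> ab.
have [f Df] := coker_map_lift (lambda_pres M) (pres F) a.
have [g Dg] := coker_map_lift (lambda_pres M) (pres F) b.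
have [|h Dh] := @proj_lift_exact _ (qQ (ppres M)) _ _ _ (pd (pres F))
  (cpr (pd (pres F))) (f - g) (qQ_proj (p := ppres M)) (cpr_exact _).
  move=> x; rewrite linBE linearB -(adj_lambdaE Df) -(adj_lambdaE Dg) ab.
  exact: subrr.
have fg : pp (pres F) _ f = pp (pres F) _ g.
  by apply/eqP; rewrite -subr_eq0 -raddfB; apply/eqP/pp_exact; exists h.
move=> Y x; have [u <-] := pp_surj (lambda_pres M) x.
by rewrite [pp _ _ _]yoneda !ntnat -Df -Dg fg.
Qed.

Lemma adj_lambda_surj M (F : modfunc C) (h : {linear M -> theta F}) :
  exists a : nattrans (theta_lambda M) F, adj_lambda a =1 h.
Proof.
have [f Df] := proj_lift (lcomp h (qe (ppres M))) (qQ_proj (p := ppres M))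
  (@cpr_surj _ _ _ (pd (pres F))).
pose Q : obj C := pX0 (lambda_pres M); pose P : obj C := pX1 (lambda_pres M).
have fE x : cpr (pd (pres F)) (f x) = h (qe (ppres M) x).
  by rewrite -[LHS]/(lcomp _ f x) Df.
have [|k Dk] := @proj_lift_exact _ (qP (ppres M)) _ _ _ (pd (pres F))
  (cpr (pd (pres F))) (lcomp f (qd (ppres M))) (qP_proj (p := ppres M)) (cpr_exact _).
  move=> x; rewrite [LHS]fE.
  suff -> : qe (ppres M) (qd (ppres M) x) = 0 by rewrite linear0.
  by apply/q_exact; exists x.
pose b (Y : obj C) (u : {linear Y -> Q}) : F Y := pp (pres F) Y (lcomp f u).
have bP Y : zmod_morphism (b Y).
  move=> u v; rewrite /b -raddfB; congr (pp _ _ _).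
  by apply: linearext => x /=; rewrite linearB.
have bp (Y : obj C) (u : {linear Y -> Q}) : pp (lambda_pres M) Y u = 0 -> b Y u = 0.
  move=> /pp_exact[v <-]; apply/pp_exact; exists (lcomp k v).
  apply: linearext => x /=.
  by rewrite -[LHS]/(lcomp (pd (pres F)) k (v x)) Dk.
pose a Y := afactor (g := mkadd (bP Y)) (pp_surj (lambda_pres M) (Y:=Y)) (@bp Y).
have aE (Y : obj C) u : sval (a Y) (pp (lambda_pres M) Y u) = b Y u := svalP (a Y) u.
have aN (Y Z : obj C) (g : {linear Y -> Z}) (x : theta_lambda M Z) :
    sval (a Y) (fmap (theta_lambda M) g x) = fmap F g (sval (a Z) x).
  have [u <-] := pp_surj (lambda_pres M) x.
  rewrite -ntnat [LHS]aE [X in fmap F g X]aE /b -ntnat.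
  by congr (pp _ _ _); apply: linearext.
exists (@Nattrans _ _ _ F _ aN) => m; have [x <-] := q_surj (ppres M) m.
rewrite (@adj_lambdaE _ _ _ f) ?fE //.
rewrite [RHS]aE; congr (pp _ _ _); exact: linearext.
Qed.

(* theta_rho(M) = Hom(-, M) restricted to C. *)
Lemma homf_fp M : fin_presented (homf C M).
Proof.
have [X0 [p Hp]] := approx (omodP M).
have [X1 [q Hq]] := approx (lker_fg p (subcat_fg (omodP X0))).
have pP (Y : obj C) : zmod_morphism (fun g : {linear Y -> X0} => lcomp p g).
  by move=> g h; apply: linearext => x /=; rewrite linearB.
have pN (Y Z : obj C) (f : {linear Y -> Z}) (x : homf C X0 Z) :
    mkadd (pP Y) (fmap (homf C X0) f x) = fmap (homf C M) f (mkadd (pP Z) x).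
  exact: linearext.
constructor; apply: (@Presentation _ _ _ X1 X0 (lcomp (kincl p) q)
  (@Nattrans _ _ _ (homf C M) _ pN)).
  by move=> Y g; have [h Dh] := Hp Y g; exists h.
move=> Y f; split=> [pf0|[h <-]]; last first.
  by apply: linearext => y /=; apply/eqP; exact: (valP (q (h y))).
have [|k Dk] := @kincl_lift _ _ _ p Y f.
  by move=> y; rewrite -[LHS]/(lcomp p f y) [lcomp p f]pf0.
have [h Dh] := Hq Y k; exists h; apply: linearext => y /=.
by rewrite -[q (h y)]/(lcomp q h y) Dh -[sval _]/(lcomp (kincl p) k y) Dk.
Qed.

Definition theta_rho M : modfunc C := Modfunc (homf_fp M).

(* The counit theta(theta_rho(M)) -> M: if X0 -> M corresponds to
   C(-, X0) -> Hom(-, M), this is the induced map Coker(X1 -> X0) -> M. *)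
Definition pres_map M : {linear pX0 (pres (theta_rho M)) -> M} :=
  pp (pres (theta_rho M)) _ (lid _).

Lemma counit_rho_subproof M :
  {h : {linear theta (theta_rho M) -> M}
   | forall x, h (cpr (pd (pres (theta_rho M))) x) = pres_map M x}.
Proof.
apply: lfactor; first exact: cpr_surj.
move=> _ /cpr_exact[y <-]; rewrite -[LHS]/(lcomp (pres_map M) (pd _) y).
have -> : lcomp (pres_map M) (pd _) = pp (pres (theta_rho M)) _ (pd _).
  by rewrite [RHS]yoneda.
suff -> : pp (pres (theta_rho M)) _ (pd _) = 0 by [].
by apply/pp_exact; exists (lid _); apply: linearext.
Qed.

Definition counit_rho M : {linear theta (theta_rho M) -> M} :=
  sval (counit_rho_subproof M).

Lemma counit_rhoE M x :
  counit_rho M (cpr (pd (pres (theta_rho M))) x) = pres_map M x.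
Proof. exact: (svalP (counit_rho_subproof M)). Qed.

Lemma pres_mapE M (Y : obj C) (f : {linear Y -> pX0 (pres (theta_rho M))}) :
  pp (pres (theta_rho M)) Y f = lcomp (pres_map M) f.
Proof. by rewrite yoneda. Qed.

(* The universal property of the counit: theta_rho is right adjoint to theta. *)
Lemma counit_rho_universal M (F : modfunc C) (h : {linear theta F -> M}) :
  exists a : nattrans F (theta_rho M),
    counit_rho M \o theta_map a =1 h /\
    forall b : nattrans F (theta_rho M),
      counit_rho M \o theta_map b =1 h -> nteq a b.
Proof.
pose Q := pres F; pose u : {linear pX0 Q -> M} := lcomp h (cpr (pd Q)).
have counitE (b : nattrans F (theta_rho M)) x :
    counit_rho M (theta_map b (cpr (pd Q) x)) =
    (b (pX0 Q) (pp Q _ (lid _)) : {linear pX0 Q -> M}) x.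
  have [g Dg] := coker_map_lift Q (pres (theta_rho M)) b.
  by rewrite /theta_map (coker_mapE Dg) counit_rhoE -Dg pres_mapE.
have cP (Y : obj C) : zmod_morphism (fun f : {linear Y -> pX0 Q} => lcomp u f).
  by move=> f g; apply: linearext => x; rewrite -[LHS]/(u (f x - g x)) linearB.
have cp (Y : obj C) (f : {linear Y -> pX0 Q}) : pp Q Y f = 0 -> lcomp u f = 0.
  move=> /pp_exact[g <-]; apply: linearext => x.
  have pd0 : cpr (pd Q) (pd Q (g x)) = 0 by apply/cpr_exact; exists (g x).
  by rewrite -[LHS]/(h (cpr (pd Q) (pd Q (g x)))) pd0 linear0.
pose a Y := afactor (g := mkadd (cP Y)) (pp_surj Q (Y:=Y)) (@cp Y).
have aE (Y : obj C) (f : {linear Y -> pX0 Q}) :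
  sval (a Y) (pp Q Y f) = lcomp u f := svalP (a Y) f.
have aN (Y Z : obj C) (g : {linear Y -> Z}) (x : F Z) :
    sval (a Y) (fmap F g x) = fmap (theta_rho M) g (sval (a Z) x).
  have [f <-] := pp_surj Q x; rewrite -ntnat [LHS]aE.
  by have -> := aE Z f; apply: linearext.
pose a' := @Nattrans _ _ F (theta_rho M) (fun Y => sval (a Y)) aN.
have a'E : a' _ (pp Q _ (lid _)) = u.
  by rewrite [LHS]aE; apply: linearext.
exists a'; split=> [q|b bh].
  have [x <-] := cpr_surj q.
  by rewrite -[LHS]/(counit_rho M (theta_map a' (cpr (pd Q) x))) counitE a'E.
have bE : b _ (pp Q _ (lid _)) = u.
  by apply: linearext => x; rewrite -counitE [LHS]bh.
move=> Y x; have [f <-] := pp_surj Q x.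
by rewrite [pp Q Y f]yoneda !ntnat a'E bE.
Qed.

Lemma counit_rho_surj M : surjective (counit_rho M).
Proof.
move=> m; have [f Df] := free_obj_elt m.
have [g Dg] := pp_surj (pres (theta_rho M)) (f : theta_rho M free_obj).
exists (cpr _ (g (const_mx 1))); rewrite counit_rhoE -Df -Dg [pp _ _ g]yoneda.
by [].
Qed.

Lemma counit_rho_inj M : injective (counit_rho M).
Proof.
suff ker0 q : counit_rho M q = 0 -> q = 0.
  move=> q r qr; apply/eqP; rewrite -subr_eq0; apply/eqP/ker0.
  by rewrite linearB qr subrr.
have [x <-] := cpr_surj q; rewrite counit_rhoE => px0; apply/cpr_exact.
have [f Df] := free_obj_elt x.
have /pp_exact[g Dg] : pp (pres (theta_rho M)) free_obj f = 0.
  rewrite pres_mapE; apply: linearext => c.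
  have Dc : c = c 0 0 *: const_mx 1.
    by apply/matrixP=> i j; rewrite !mxE !ord1 mulr1.
  rewrite Dc -[LHS]/(pres_map M (f (c 0 0 *: const_mx 1))).
  by rewrite (linearZ_LR f) Df linearZ_LR px0 scaler0.
by exists (g (const_mx 1)); rewrite -Df -Dg.
Qed.

Lemma counit_rho_inv_subproof M :
  {h : {linear M -> theta (theta_rho M)} | forall q, h (counit_rho M q) = q}.
Proof.
have [|q|h Dh] := @lfactor _ _ _ _ (counit_rho M) (lid _).
- exact: counit_rho_surj.
- by rewrite -(linear0 (counit_rho M)) => /counit_rho_inj.
- by exists h.
Qed.

Definition counit_rho_inv M : {linear M -> theta (theta_rho M)} :=
  sval (counit_rho_inv_subproof M).

Lemma counit_rhoK M : cancel (counit_rho M) (counit_rho_inv M).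
Proof. exact: (svalP (counit_rho_inv_subproof M)). Qed.

Lemma counit_rhoVK M : cancel (counit_rho_inv M) (counit_rho M).
Proof. by move=> m; have [q <-] := counit_rho_surj m; rewrite counit_rhoK. Qed.

(* The map theta_lambda(M) -> theta_rho(M) corresponding to the inverse of the
   counit under the adjunction. *)
Definition gamma M : nattrans (theta_lambda M) (theta_rho M) :=
  sval (cid (adj_lambda_surj (F := theta_rho M) (counit_rho_inv M))).

Lemma gammaE M : adj_lambda (F := theta_rho M) (gamma M) =1 counit_rho_inv M.
Proof. exact: (svalP (cid (adj_lambda_surj _))). Qed.

Definition zeta M : modfunc C :=
  Modfunc (imf_fp (gamma M) (mfunP (theta_lambda M)) (mfunP (theta_rho M))).

End IntermediateExtension.

(* F(X) is a right module over End(X): x.g = F(g)(x). *)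
Section Evaluation.
Context {B : pzRingType} {C : subcat B}.
Variables (F : func C) (X : obj C).

Definition eval : Type := F X.
HB.instance Definition _ := GRing.Zmodule.on eval.

Definition eval_scale (g : (endo X)^c) (x : eval) : eval := fmap F g x.
Fact eval_scaleA g h x : eval_scale g (eval_scale h x) = eval_scale (g * h) x.
Proof. by rewrite /eval_scale -fmap_comp. Qed.
Fact eval_scale1 : left_id 1 eval_scale.
Proof. exact: fmap_id. Qed.
Fact eval_scaleDr : right_distributive eval_scale +%R.
Proof. by move=> g x y; apply: raddfD. Qed.
Fact eval_scaleDl x : {morph eval_scale^~ x : g h / g + h}.
Proof. by move=> g h; apply: fmapD. Qed.
HB.instance Definition _ := GRing.Zmodule_isLmodule.Build ((endo X)^c) eval
  eval_scaleA eval_scale1 eval_scaleDr eval_scaleDl.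

Lemma evalE (g : (endo X)^c) (x : eval) : g *: x = fmap F g x. Proof. by []. Qed.
End Evaluation.

Definition perp (A : pzRingType) (M : rmodType A) :=
  forall n, ext_succ_eq0 n M (rreg A).

Section SubcatProperties.
Context {B : pzRingType} (C : subcat B).

Definition finite_type :=
  exists n (S : 'I_n -> lmodType B), forall U, C U -> indecomposable U ->
    exists i, isomorphic U (S i).

(* C = add(X). *)
Definition additive_generator (X : lmodType B) :=
  forall U, C U <-> exists n, summand U {ffun 'I_n -> X}.

Definition closed_under_syzygies :=
  forall (K P M : lmodType B) (i : {linear K -> P}) (p : {linear P -> M}),
    fin_gen K -> fin_gen P -> projective P ->
    injective i -> exact_at i p -> surjective p -> C M -> C K.

Definition closed_under_submodules :=
  forall (U M : lmodType B) (i : {linear U -> M}), injective i -> C M -> C U.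

End SubcatProperties.

(* Main.v *)
Require Import Defs.
From HB Require Import structures.
From mathcomp Require Import all_boot all_algebra.
From mathcomp Require Import boolp classical_sets functions.
Import Defs.

Set Implicit Arguments.
Unset Strict Implicit.
Unset Printing Implicit Defensive.

Import GRing.Theory.
Local Open Scope ring_scope.

(** T is the right ideal of the endomorphisms of X that factor through a
    projective module: the map gamma from theta_lambda(X) to theta_rho(X) is, at
    X, the composition Coker(Hom(X, P) -> Hom(X, Q)) -> Hom(X, X) with the cover
    q : Q -> X of a projective presentation P -> Q -> X -> 0 ([zeta_image]).
    Since every Y in C is a summand of a power of X, Hom(X, Y) is a finitely
    generated projective Gamma-module, and Gamma-linear maps
    Hom(X, Y) -> Hom(X, Z) are compositions with maps Y -> Z. So questions about
    Gamma-modules become questions about modules in C.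

    The key property of T is [projideal_extend]: given a short exact sequence
    0 -> K -> Z -> U -> 0 in C, every map Hom(X, K) -> T extends to Hom(X, Z).
    Indeed it is composition with a map K -> Q followed by Hom(X, Q) -> T, and
    K -> Q extends to Z because Ext^1(U, Q) = 0.

    Tilting. If K = ker q is in C, then 0 -> Hom(X, K) -> Hom(X, Q) -> T -> 0 is
    a projective resolution, and the key property for 0 -> K -> Q -> X -> 0
    gives Ext^1(T, T) = 0. As for the number of summands, the endomorphisms of T are
    those of X: a Gamma-linear endomorphism of T lifts to an endomorphism of Q
    that induces one of X ([projideal_endo_surj]). Indecomposable summands of a
    module are primitive idempotents of its endomorphism ring up to equivalence,
    so X, T and Gamma have equally many of them, and finitely many because C has
    finite type.

    Cotilting. Embed T into an injective module I. Baer's criterion shows that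
    I/T is injective: a right ideal J of Gamma is finitely generated, hence the
    image of Hom(X, d) for some d : X^m -> X, and its kernel Hom(X, ker d) has
    ker d in C when C is closed under submodules. A map J -> I/T lifts to
    Hom(X, X^m) -> I, and the key property for
    0 -> ker d -> X^m -> im d -> 0 corrects the lift so that it factors
    through J; it then extends to Gamma because I is injective. That every
    module embeds into an injective one is proved with modules coinduced from divisible
    groups. *)

(** * Direct summands and idempotents *)

Section Idempotents.
Context {B : pzRingType}.
Implicit Types U V W : lmodType B.

Lemma isomorphic_sym U V : isomorphic U V -> isomorphic V U.
Proof.
move=> [f [g fK gK]].
have gP : linear g by move=> a x y; apply: (can_inj fK); rewrite gK linearP !gK.
by exists (mklin gP), f.
Qed.

Lemma isomorphic_trans U V W :
  isomorphic U V -> isomorphic V W -> isomorphic U W.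
Proof. by move=> [f fB] [g gB]; exists (lcomp g f); apply: bij_comp. Qed.

Lemma summand_isoL U V W : isomorphic U V -> summand U W -> summand V W.
Proof.
move=> /isomorphic_sym[f [g fK gK]] [S WS]; exists S; apply: isomorphic_trans WS _.
have hP : linear (fun x : (U * S)%type => (g x.1, x.2) : (V * S)%type).
  have gP : linear g by move=> a x y; apply: (can_inj fK); rewrite gK linearP !gK.
  by move=> a x y; congr pair; exact: gP.
by exists (mklin hP), (fun x => (f x.1, x.2)) => -[x y] /=; rewrite ?gK ?fK.
Qed.

Definition splits U (e : endo U) V :=
  exists (i : {linear V -> U}) (p : {linear U -> V}),
    cancel i p /\ i \o p =1 e.

Lemma retract_iso U V (i : {linear V -> U}) (p : {linear U -> V}) :
  cancel i p -> isomorphic U (V * lker p)%type.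
Proof.
move=> iK.
have [|q Dq] := @kincl_lift _ _ _ p U (lid U - lcomp i p).
  by move=> u; rewrite linBE linearB /= iK subrr.
have qE u : kincl p (q u) = u - i (p u) by rewrite -[LHS]/(lcomp _ q u) Dq.
have fP : linear (fun u : U => (p u, q u)) by move=> a x y; rewrite !linearP.
exists (mklin fP), (fun x => i x.1 + kincl p x.2) => [u|[v w]] /=.
  by rewrite [sval _]qE addrC subrK.
have pw : p (kincl p w) = 0 by apply/kincl_exact; exists w.
congr pair; first by rewrite linearD iK [X in _ + X]pw addr0.
apply: (@kincl_inj _ _ _ p); rewrite qE linearD iK [X in _ - i (_ + X)]pw.
by rewrite addr0 addrC addKr.
Qed.

Lemma summand_refl U : summand U U.
Proof. by exists (lker (lid U)); exact: (@retract_iso _ _ (lid U) (lid U)). Qed.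

Lemma splits_summand U (e : endo U) V : splits e V -> summand V U.
Proof. by move=> [i [p [iK _]]]; exists (lker p); apply: retract_iso iK. Qed.

Lemma splits_idem U (e : endo U) V : splits e V -> e * e = e.
Proof.
by move=> [i [p [iK ip]]]; apply: linearext => u /=; rewrite -!ip /= iK.
Qed.

Lemma pair_splits U V W (f : {linear U -> (V * W)%type}) g :
  cancel f g -> cancel g f ->
  exists (i : {linear V -> U}) (p : {linear U -> V}),
    [/\ cancel i p, p =1 fst \o f & i =1 fun v => g (v, 0)].
Proof.
move=> fK gK; have pP : linear (fst \o f) by move=> a x y; rewrite /= linearP.
have iP : linear (fun v : V => g (v, 0 : W)).
  move=> a x y; apply: (can_inj fK); rewrite gK linearP !gK.
  by rewrite -[RHS]/(a *: x + y, a *: (0 : W) + 0) scaler0 addr0.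
by exists (mklin iP), (mklin pP); split=> // v /=; rewrite gK.
Qed.

Lemma summand_splits U V : summand V U -> exists e : endo U, splits e V.
Proof.
move=> [W [f [g fK gK]]]; have [i [p [iK _ _]]] := pair_splits fK gK.
by exists (lcomp i p : endo U), i, p.
Qed.

Lemma idem_splits U (e : endo U) : e * e = e -> exists V, splits e V.
Proof.
move=> ee; exists (lker (lid U - e)).
have eeE u : e (e u) = e u by rewrite -[in RHS]ee.
have [|p Dp] := @kincl_lift _ _ _ (lid U - e) U e.
  by move=> u; rewrite linBE /= eeE subrr.
have pE u : kincl _ (p u) = e u by rewrite -[LHS]/(lcomp _ p u) Dp.
exists (kincl _), p; split=> // v; apply: (@kincl_inj _ _ _ (lid U - e)).
rewrite pE; apply/esym/eqP; rewrite -subr_eq0; apply/eqP.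
by have /kincl_exact : exists w, kincl (lid U - e) w = kincl _ v by exists v.
Qed.

(** Murray-von Neumann equivalence; for idempotents it says that they split
    isomorphic modules. *)
Definition idem_equiv (A : pzRingType) (e f : A) :=
  exists a b : A, a * b = f /\ b * a = e.

Definition primitive_idem (A : pzRingType) (e : A) :=
  [/\ e * e = e, e <> 0 &
      forall f, f * f = f -> e * f = f -> f * e = f -> f = 0 \/ f = e].

Lemma splits_iso U (e f : endo U) V W :
  splits e V -> splits f W -> (isomorphic V W <-> idem_equiv e f).
Proof.
move=> eV fW; have ee := splits_idem eV; have ff := splits_idem fW.
move: eV fW => [i [p [iK ip]]] [j [q [jK jq]]]; split.
  move=> VW; have [u [v uK vK]] := VW.
  have vP : linear v by move=> a x y; apply: (can_inj uK); rewrite vK linearP !vK.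
  exists (lcomp j (lcomp u p) : endo U), (lcomp i (lcomp (mklin vP) q) : endo U).
  split; apply: linearext => x /=.
    by rewrite iK vK; exact: jq.
  by rewrite jK uK; exact: ip.
move=> [a [b [ab ba]]].
have abE x : a (b x) = f x by rewrite -ab.
have baE x : b (a x) = e x by rewrite -ba.
have ipE x : i (p x) = e x := ip x.
have jqE x : j (q x) = f x := jq x.
have eiE x : e (i x) = i x by rewrite -ipE iK.
have fjE x : f (j x) = j x by rewrite -jqE jK.
exists (lcomp q (lcomp a i)), (lcomp p (lcomp b j)) => x /=.
  by rewrite jqE -abE !baE !eiE iK.
by rewrite ipE -baE !abE !fjE jK.
Qed.

(** Idempotents below e are idempotent endomorphisms of V, that is,
    decompositions of V into two summands. *)
Lemma splits_indecomposable U (e : endo U) V : splits e V ->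
  (indecomposable V <-> primitive_idem e).
Proof.
move=> eV; have ee := splits_idem eV; move: eV => [i [p [iK ip]]].
have ipE x : i (p x) = e x := ip x.
have eiE x : e (i x) = i x by rewrite -ipE iK.
split=> [[nzV indV]|[_ nze prime]].
  split=> // [e0|f ff ef fe].
    by apply: nzV => v; rewrite -[v]iK -[i v]eiE e0 linear0.
  have efE x : e (f x) = f x by rewrite -[in RHS]ef.
  have feE x : f (e x) = f x by rewrite -[in RHS]fe.
  have ffE x : f (f x) = f x by rewrite -[in RHS]ff.
  (* the idempotent of V corresponding to f *)
  pose f' : endo V := lcomp p (lcomp f i).
  have [|W [j [q [jK jq]]]] := @idem_splits V f'.
    by apply: linearext => v /=; rewrite ipE efE ffE.
  have jqE v : j (q v) = f' v := jq v.
  have ff' x : f x = i (f' (p x)) by rewrite /= !ipE feE efE.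
  have [W0|K0] := indV _ _ (retract_iso jK); [left|right]; apply: linearext => x.
    by rewrite ff' -jqE (W0 (q _)) !linear0.
  rewrite ff'; have -> : f' (p x) = p x; last exact: ipE.
  have [|w Dw] := (@kincl_exact _ _ _ q (p x - f' (p x))).1.
    by rewrite linearB -jqE jK subrr.
  by apply/esym/eqP; rewrite -subr_eq0 -Dw (K0 w) linear0.
split=> [V0|V1 V2 [u [v uK vK]]].
  by apply: nze; apply: linearext => x; rewrite -ipE (V0 (p x)) linear0.
have [j [q [jK qE jE]]] := pair_splits uK vK.
pose f : endo U := lcomp i (lcomp j (lcomp q p)).
have [|||f0|fe] := prime f.
- by apply: linearext => x /=; rewrite iK jK.
- by apply: linearext => x /=; rewrite eiE.
- by apply: linearext => x /=; rewrite -ipE iK.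
- left=> w; have : f (i (j w)) = 0 by rewrite f0.
  rewrite /= iK jK -(linear0 i) => /(can_inj iK); rewrite -(linear0 j).
  exact: (can_inj jK).
right=> w; pose z := v (0, w).
have : f (i z) = i z by rewrite fe eiE.
rewrite /= iK => /(can_inj iK); rewrite qE /= vK linear0 => z0.
by have := vK (0, w); rewrite -/z -z0 linear0 => -[].
Qed.

End Idempotents.

(** Idempotents up to equivalence count the summands inside the endomorphism
    ring, so that modules with isomorphic endomorphism rings have as many
    indecomposable summands. *)
Definition num_primitive_idems (A : pzRingType) (n : nat) :=
  exists e : 'I_n -> A,
    [/\ forall i, primitive_idem (e i),
        forall i j, idem_equiv (e i) (e j) -> i = j
      & forall f, primitive_idem f -> exists i, idem_equiv f (e i)].

Lemma num_indec_summandsE (B : pzRingType) (U : lmodType B) n :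
  num_indec_summands U n <-> num_primitive_idems (endo U) n.
Proof.
split=> [[S [indS injS allS]]|[e [prime inje alle]]].
  have /choice[e eS] i := summand_splits (indS i).2.
  exists e; split=> [i|i j /(splits_iso (eS i) (eS j))/injS //|f primf].
    by apply/(splits_indecomposable (eS i)); exact: (indS i).1.
  have [V fV] := idem_splits (let: And3 ff _ _ := primf in ff).
  have [||i VS] := allS V; first exact/(splits_indecomposable fV).
    exact: splits_summand fV.
  by exists i; apply/(splits_iso fV (eS i)).
have /choice[S eS] i : exists V, splits (e i) V.
  by apply: idem_splits; case: (prime i).
exists S; split=> [i|i j /(splits_iso (eS i) (eS j))/inje //|V indV /summand_splits].
  split; first exact/(splits_indecomposable (eS i)).
  exact: splits_summand (eS i).
move=> [f fV]; have [|i fe] := alle f; first exact/(splits_indecomposable fV).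
by exists i; apply/(splits_iso fV (eS i)).
Qed.

(** Primitivity and equivalence of idempotents are expressed by products and 0,
    and a multiplicative bijection maps 0, the absorbing element, to 0. *)
Lemma num_primitive_idems_iso (A A' : pzRingType) (phi : A -> A') n :
  bijective phi -> {morph phi : a b / a * b} ->
  num_primitive_idems A n -> num_primitive_idems A' n.
Proof.
move=> [psi phiK psiK] phiM [e [prime inje alle]].
have psiM : {morph psi : a b / a * b}.
  by move=> a b; apply: (can_inj phiK); rewrite phiM !psiK.
have phi0 : phi 0 = 0.
  by rewrite -[X in phi X](mul0r (psi 0)) phiM psiK mulr0.
have phi_prim a : primitive_idem a -> primitive_idem (phi a).
  move=> [aa nza pa]; split=> [|pa0|f ff af fa].
  - by rewrite -phiM aa.
  - by apply: nza; apply: (can_inj phiK); rewrite pa0 phi0.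
  have [|||/(congr1 phi)|/(congr1 phi)] := pa (psi f); rewrite ?psiK ?phi0.
  - by rewrite -psiM ff.
  - by rewrite -[a in LHS]phiK -psiM af.
  - by rewrite -[a in LHS]phiK -psiM fa.
  - by left.
  - by right.
have psi_prim f : primitive_idem f -> primitive_idem (psi f).
  move=> [ff nzf pf]; split=> [|/(congr1 phi)|a aa fa af].
  - by rewrite -psiM ff.
  - by rewrite psiK phi0.
  have [|||a0|af'] := pf (phi a); rewrite -?phiM ?aa //.
  - by rewrite -[f]psiK -phiM fa.
  - by rewrite -[f]psiK -phiM af.
  - by left; apply: (can_inj phiK); rewrite phi0.
  - by right; rewrite -af' phiK.
exists (phi \o e); split=> [i|i j [a [b [ab ba]]]|f /psi_prim/alle[i [a [b [ab ba]]]]].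
- exact: phi_prim.
- apply: inje; exists (psi a), (psi b).
  by rewrite -!psiM ab ba /= !phiK.
- by exists i, (phi a), (phi b); rewrite -!phiM ab ba psiK.
Qed.

(** ** Existence of the number of summands *)

Lemma summand_add (B : pzRingType) (C : subcat B) (X U : lmodType B) :
  additive_generator C X -> summand U X -> C U.
Proof.
move=> genX [W XUW]; apply/genX; exists 1%N, W; apply: isomorphic_trans XUW.
have fP : linear (fun x : {ffun 'I_1 -> X} => x ord0).
  by move=> a x y; rewrite !ffunE.
exists (mklin fP), (fun x => [ffun=> x]) => x /=; last by rewrite ffunE.
by apply/ffunP=> i; rewrite ffunE; congr (x _); apply: val_inj; case: i => -[].
Qed.

Lemma num_indec_summands_exists (B : pzRingType) (C : subcat B)
    (X : lmodType B) : finite_type C -> additive_generator C X ->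
  exists n, num_indec_summands X n.
Proof.
move=> [m [S allS]] genX.
pose good i := indecomposable (S i) /\ summand (S i) X.
(* one representative, of least index, in each isomorphism class *)
pose first i := forall j, good j -> isomorphic (S i) (S j) -> (i <= j)%N.
pose A : {set 'I_m} := [set i | `[< good i /\ first i >]].
have AP i : reflect (good i /\ first i) (i \in A).
  by rewrite inE; apply: asboolP.
exists #|A|, (fun k => S (enum_val k)); split=> [k|j k jk|V indV VX].
- by have /AP[] := enum_valP k.
- have /AP[gj fj] := enum_valP j; have /AP[gk fk] := enum_valP k.
  apply/enum_val_inj/val_inj/anti_leq; rewrite fj // fk //.
  exact: isomorphic_sym.
have [i0 Vi0] := allS V (summand_add genX VX) indV.
have gi0 : good i0.
  split; last exact: summand_isoL Vi0 VX.
  case: indV => nzV indV; split=> [S0|W1 W2 /(isomorphic_trans Vi0)/indV //].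
  case: Vi0 => f [g fK _]; apply: nzV => v.
  by rewrite -[v]fK (S0 (f v)) -(S0 (f 0)) fK.
pose P i := `[< good i /\ isomorphic V (S i) >].
have Pi0 : P i0 by apply/asboolP.
have [i /asboolP[gi Vi] mini] := arg_minnP (fun i : 'I_m => i : nat) Pi0.
have Ai : i \in A.
  apply/AP; split=> // j gj ij; apply: mini; apply/asboolP; split=> //.
  exact: isomorphic_trans Vi ij.
by exists (enum_rank_in Ai i); rewrite enum_rankK_in.
Qed.

(** * Extending maps along short exact sequences *)

Section Extension.
Context {B : pzRingType}.
Implicit Types U V W : lmodType B.

(** Any other projective module mapping onto T is compared with A through lifts
    in both directions, so that A alone decides whether Ext^1(T, V) vanishes. *)
Lemma ext1_eq0_of_cover (A T V : lmodType B) (pi : {linear A -> T}) :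
  projective A -> surjective pi ->
  (forall k : {linear lker pi -> V},
     exists h : {linear A -> V}, forall x, h (kincl pi x) = k x) ->
  ext_succ_eq0 0 T V.
Proof.
move=> projA surjpi extA P d e [projP surje exde exd] f fd0.
have [c Dc] : {c : {linear P 1%N -> lker e} | lcomp (kincl e) c = d 0%N}.
  by apply: kincl_lift => x; apply/exde; exists x.
have cE x : kincl e (c x) = d 0%N x by rewrite -Dc.
have [||k kE] := @lfactor _ _ _ _ c f.
- move=> y; have /exde[x xy] : e (kincl e y) = 0 by apply/kincl_exact; exists y.
  by exists x; apply: (@kincl_inj _ _ _ e); rewrite cE.
- move=> x cx0; have /exd[y <-] : d 0%N x = 0 by rewrite -cE cx0 linear0.
  exact: fd0.
have [a Da] := proj_lift pi projA surje.
have aE x : e (a x) = pi x by rewrite -Da.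
have [b Db] := proj_lift e (projP 0%N) surjpi.
have bE x : pi (b x) = e x by rewrite -Db.
have [a' Da'] : {a' : {linear lker pi -> lker e} |
    lcomp (kincl e) a' = lcomp a (kincl pi)}.
  by apply: kincl_lift => x; rewrite /= aE; apply/kincl_exact; exists x.
have a'E x : kincl e (a' x) = a (kincl pi x) by rewrite -[LHS]/(lcomp _ a' x) Da'.
have [h hE] := extA (lcomp k a').
(* a b differs from the identity by a map r into the kernel of e *)
have [r Dr] : {r : {linear P 0%N -> lker e} |
    lcomp (kincl e) r = lid _ - lcomp a b}.
  by apply: kincl_lift => x; rewrite linBE linearB /= aE bE subrr.
have rE x : kincl e (r x) = x - a (b x) by rewrite -[LHS]/(lcomp _ r x) Dr.
exists (lcomp h b + lcomp k r) => x; rewrite -[LHS]/(h (b (d 0%N x)) + k (r (d 0%N x))).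
have /kincl_exact[y Dy] : pi (b (d 0%N x)) = 0 by rewrite bE; apply/exde; exists x.
rewrite -Dy hE /= -linearD -kE; congr (k _); apply: (@kincl_inj _ _ _ e).
by rewrite linearD a'E rE Dy cE addrC subrK.
Qed.

Lemma inj_lift (W U V : lmodType B) (i : {linear U -> V}) (g : {linear W -> V}) :
  injective i -> (forall w, exists u, i u = g w) ->
  exists h : {linear W -> U}, forall w, i (h w) = g w.
Proof.
move=> inji /choice[h hE]; have hP : linear h.
  by move=> a x y; apply: inji; rewrite linearP !hE linearP.
by exists (mklin hP).
Qed.

Section Noetherian.
Hypothesis noethB : noetherian B.

(** A step in the construction of a resolution: a module whose map still has
    to be made exact on the left. With the target as a field, the next step has
    the present module as its target by computation, and the maps of all the
    steps form a complex without transport along equalities. *)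
Record stage := Stage {
  stageP : lmodType B;
  stageW : lmodType B;
  staged : {linear stageP -> stageW};
  stage_fg : fin_gen stageP;
  stage_proj : projective stageP }.

Lemma next_stage_subproof (s : stage) : exists t : {P : lmodType B &
    {linear P -> stageP s}},
  [/\ fin_gen (projT1 t), projective (projT1 t)
    & exact_at (projT2 t) (staged s)].
Proof.
have [n [f surjf]] := fin_gen_cover (lker_fg noethB (staged s) (@stage_fg s)).
exists (existT _ ('rV[B]_n : lmodType B) (lcomp (kincl (staged s)) f)); split => /=.
- exact: free_fin_gen.
- exact: free_projective.
move=> x; split=> [/kincl_exact[y <-]|[y <-]].
  by have [z <-] := surjf y; exists z.
by apply/kincl_exact; exists (f y).
Qed.

Definition next_stage (s : stage) : stage :=
  let t := cid (next_stage_subproof s) in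
  @Stage _ _ (projT2 (sval t))
    (let: And3 fg _ _ := svalP t in fg) (let: And3 _ proj _ := svalP t in proj).

Lemma next_stage_exact s : exact_at (staged (next_stage s)) (staged s).
Proof. by rewrite /next_stage /=; case: cid => t []. Qed.

Lemma proj_resolution_exists (s : stage) : surjective (staged s) ->
  proj_resolution (P := fun n => stageP (iter n next_stage s))
    (fun n => staged (iter n.+1 next_stage s)) (staged s).
Proof.
move=> surjs; split=> // [n||n].
- exact: stage_proj.
- exact: next_stage_exact.
- exact: next_stage_exact.
Qed.

Lemma ext1_extend_proj (P U V : lmodType B) (e : {linear P -> U}) :
  fin_gen P -> projective P -> surjective e -> ext_succ_eq0 0 U V ->
  forall k : {linear lker e -> V},
    exists g : {linear P -> V}, forall x, g (kincl e x) = k x.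
Proof.
move=> fgP projP surje extUV k.
pose s := Stage e fgP projP; pose s1 := next_stage s.
have ex1 : exact_at (staged s1) e := @next_stage_exact s.
have [c Dc] : {c : {linear stageP s1 -> lker e} | lcomp (kincl e) c = staged s1}.
  by apply: kincl_lift => x; apply/ex1; exists x.
have cE x : kincl e (c x) = staged s1 x by rewrite -Dc.
have [x|g gE] := extUV _ _ _ (@proj_resolution_exists s surje) (lcomp k c).
  rewrite /= -(linear0 k); congr (k _); apply: (@kincl_inj _ _ _ e).
  by rewrite linear0 cE; apply/(@next_stage_exact s1); exists x.
exists g => y; have /ex1[x Dx] : e (kincl e y) = 0 by apply/kincl_exact; exists y.
rewrite -Dx; apply: etrans (gE x) _; congr (k _).
by apply: (@kincl_inj _ _ _ e); rewrite cE.
Qed.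

(** Covering Z by a free module P, a map defined on K is extended to P; the
    extension vanishes on the kernel of P -> Z and so descends to Z. *)
Lemma ext1_extend (K Z U V : lmodType B) (i : {linear K -> Z})
    (e : {linear Z -> U}) :
  fin_gen Z -> injective i -> exact_at i e -> surjective e ->
  ext_succ_eq0 0 U V ->
  forall k : {linear K -> V}, exists g : {linear Z -> V}, forall x, g (i x) = k x.
Proof.
move=> fgZ inji exie surje extUV k; have [n [p surjp]] := fin_gen_cover fgZ.
have surjep : surjective (lcomp e p).
  by move=> u; have [z <-] := surje u; have [x <-] := surjp z; exists x.
have [x|q qE] := @inj_lift _ _ _ i (lcomp p (kincl (lcomp e p))) inji.
  by apply/exie; apply/(@kincl_exact _ _ _ (lcomp e p)); exists x.
have [g gE] := ext1_extend_proj (free_fin_gen n) (@free_projective B n) surjep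
  extUV (lcomp k q).
have [//||h hE] := @lfactor _ _ _ _ p g.
  move=> x px0; have /kincl_exact[y Dy] : lcomp e p x = 0 by rewrite /= px0 linear0.
  rewrite -Dy gE /= -(linear0 k); congr (k _); apply: inji.
  by rewrite linear0 qE -[RHS]px0 -Dy.
exists h => y; have [x Dx] := surjp (i y).
have /kincl_exact[w Dw] : lcomp e p x = 0 by rewrite /= Dx; apply/exie; exists y.
rewrite -Dx hE -Dw gE /=; congr (k _); apply: inji.
by rewrite qE -Dx -Dw.
Qed.

End Noetherian.
End Extension.

(** A finitely generated projective module is a retract of a free one, into
    which maps are extended coordinate by coordinate. *)
Lemma ext1_extend_to_proj (A : pzRingType) (noethA : noetherian A^c)
    (K Z U Q : rmodType A) (i : {linear K -> Z}) (e : {linear Z -> U}) :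
  fin_gen Z -> injective i -> exact_at i e -> surjective e ->
  ext_succ_eq0 0 U (rreg A) -> fin_gen Q -> projective Q ->
  forall k : {linear K -> Q}, exists g : {linear Z -> Q}, forall x, g (i x) = k x.
Proof.
move=> fgZ inji exie surje extU fgQ projQ k.
have [n [p surjp]] := fin_gen_cover fgQ.
have [s Ds] := proj_lift (lid Q) projQ surjp.
have coordP (j : 'I_n) : linear (fun c : 'rV[A^c]_n => c 0 j : rreg A).
  by move=> a x y; rewrite !mxE.
pose coord j := mklin (coordP j).
have /choice[g gE] j := ext1_extend noethA fgZ inji exie surje extU
  (lcomp (coord j) (lcomp s k)).
have hP : linear (fun z => \row_j g j z : 'rV[A^c]_n).
  by move=> a x y; apply/rowP=> j; rewrite !mxE linearP.
exists (lcomp p (mklin hP)) => x /=.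
have -> : \row_j g j (i x) = s (k x) by apply/rowP=> j; rewrite mxE gE.
by rewrite -[LHS]/(lcomp p s (k x)) Ds.
Qed.

(** * Injective modules *)

Section Baer.
Context {B : pzRingType}.
Implicit Types V I : lmodType B.

Definition baer_module I := forall (J : B^o -> Prop) (f : B^o -> I),
  submodule J ->
  (forall a u v, J u -> J v -> f (a *: u + v) = a *: f u + f v) ->
  exists x : I, forall u : B^o, J u -> f u = (u : B) *: x.

(** Partial linear maps are given by their graphs, which makes unions of chains
    immediate. *)
Definition partial_lin V I (G : V * I -> Prop) :=
  submodule (V := (V * I)%type) G /\ forall y, G (0, y) -> y = 0.

(** A partial map into a module that satisfies Baer's condition extends to one
    more element v: apply the condition to the ideal of the scalars that bring v
    into the domain. Zorn's lemma does the rest. *)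
Lemma partial_lin_total V I (G0 : V * I -> Prop) :
  baer_module I -> partial_lin G0 ->
  exists h : {linear V -> I}, forall v y, G0 (v, y) -> h v = y.
Proof.
move=> baerI plG0.
(* the empty set is admitted as the union of the empty chain *)
pose P (G : set (V * I)%type) := G = set0 \/ (partial_lin G /\ (G0 `<=` G)%classic).
have [|G [PG maxG]] := @Zorn_bigcup (V * I)%type P.
  move=> F FP totF.
  have [[G1 [FG1 nzG1]]|allG] := pselect (exists G, F G /\ G <> set0); last first.
    left; apply/seteqP; split=> // x [G FG Gx]; case: allG; exists G; split=> // G00.
    by rewrite G00 in Gx.
  have plF G x : F G -> G x -> partial_lin G /\ (G0 `<=` G)%classic.
    by move=> FG Gx; case: (FP G FG) => // G00; rewrite G00 in Gx.
  have [plG1 G01] : partial_lin G1 /\ (G0 `<=` G1)%classic by case: (FP G1 FG1).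
  right; split; last by move=> x /G01 G1x; exists G1.
  split=> [|y [G FG Gy]]; last exact: (plF G _ FG Gy).1.2.
  split=> [|a u v [G FG Gu] [H FH Hv]]; first by exists G1 => //; exact: plG1.1.1.
  have [/(_ _ Gu) Hu|/(_ _ Hv) Gv] := totF G H FG FH.
    by exists H => //; apply: (plF H _ FH Hv).1.1.2.
  by exists G => //; apply: (plF G _ FG Gu).1.1.2.
have Pmax H : partial_lin H -> (G0 `<=` H)%classic -> (G `<=` H)%classic -> H = G.
  move=> plH G0H GH; apply: contrapT => HG; apply: (maxG H); last by right.
  by split=> // HsG; apply: HG; apply/seteqP.
have [{}plG G0G] : partial_lin G /\ (G0 `<=` G)%classic.
  case: PG => // G00; have DG : G0 = G by apply: Pmax => //; rewrite G00.
  by rewrite -DG; split.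
have [subG funG] := plG.
have GD a (u w : V) (x y : I) : G (u, x) -> G (w, y) -> G (a *: u + w, a *: x + y).
  by move=> Gu Gw; exact: (subG.2 a (u, x) (w, y) Gu Gw).
have Guniq u x y : G (u, x) -> G (u, y) -> x = y.
  move=> Gx Gy; apply/eqP; rewrite -subr_eq0; apply/eqP/funG.
  by have := GD (-1) u u y x Gy Gx; rewrite !scaleN1r addNr [- y + x]addrC.
have total v : exists y, G (v, y).
  pose J (b : B^o) := exists y, G ((b : B) *: v, y).
  have /choice[f fE] b : exists y, J b -> G ((b : B) *: v, y).
    by have [[y Gy]|nJ] := pselect (J b); [exists y|exists 0].
  have subJ : submodule J.
    split=> [|a u w [x Gx] [y Gy]].
      by exists 0; rewrite scale0r; exact: subG.1.
    exists (a *: x + y); rewrite scalerDl -[a *: u]/(a * u) -scalerA; exact: GD.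
  have [|x xE] := baerI J f subJ.
    move=> a u w Ju Jw; have Juw := subJ.2 a u w Ju Jw.
    apply: (Guniq ((a *: u + w : B) *: v)); first exact: fE.
    rewrite scalerDl -[a *: u]/(a * u) -scalerA; apply: GD; exact: fE.
  pose H (z : (V * I)%type) := exists u y b,
    G (u, y) /\ z = (u + b *: v, y + b *: x).
  suff <- : H = G.
    exists x, 0, 0, 1; rewrite scale1r add0r scale1r add0r.
    by split=> //; exact: subG.1.
  apply: Pmax => [|[u y]|[u y]]; last 2 first.
  - by move=> /G0G Gu; exists u, y, 0; rewrite !scale0r !addr0.
  - by move=> Gu; exists u, y, 0; rewrite !scale0r !addr0.
  split=> [|y [u [z [b [Gz [E ->]]]]]].
    split; first by exists 0, 0, 0; rewrite !scale0r !addr0; split=> //; exact: subG.1.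
    move=> a _ _ [u [y [b [Gu ->]]]] [w [z [c [Gw ->]]]].
    exists (a *: u + w), (a *: y + z), (a * b + c); split; first exact: GD.
    rewrite -[LHS]/(a *: (u + b *: v) + (w + c *: v), a *: (y + b *: x) + (z + c *: x)).
    by rewrite !scalerDr !scalerDl !scalerA; congr pair; apply: addrACA.
  have Du : b *: v = - u by apply/eqP; rewrite -addr_eq0 addrC -E.
  have GN : G (b *: v, - z).
    by rewrite Du; have := GD (-1) u 0 z 0 Gz subG.1; rewrite !scaleN1r !addr0.
  have <- : f b = b *: x by apply: xE; exists (- z).
  have -> : f b = - z.
    by apply: (Guniq (b *: v)) => //; apply: fE; exists (- z).
  exact: subrr.
have /choice[h hE] := total.
have hP : linear h.
  by move=> a u w; apply: Guniq (hE _) _; apply: GD; apply: hE.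
by exists (mklin hP) => v y /G0G Gv; apply: Guniq Gv.
Qed.

End Baer.

Lemma injective_of_baer (B : pzRingType) (I : lmodType B) :
  baer_module I -> injective_module I.
Proof.
move=> baerI U V g f injg.
pose G (z : (V * I)%type) := exists u, z = (g u, f u).
have [|h hE] := @partial_lin_total B V I G baerI; last first.
  by exists h => u; apply: hE; exists u.
split=> [|y [u [u0 ->]]].
  split=> [|a _ _ [u ->] [v ->]]; first by exists 0; rewrite !linear0.
  by exists (a *: u + v); rewrite !linearP.
by rewrite (injg u 0) ?linear0.
Qed.

(** Both maps factor through the quotient by the kernel of d, which embeds
    into V. *)
Lemma injective_extend (B : pzRingType) (I U V : lmodType B) (d : {linear U -> V})
    (f : {linear U -> I}) :
  injective_module I -> (forall u, d u = 0 -> f u = 0) ->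
  exists h : {linear V -> I}, forall u, h (d u) = f u.
Proof.
move=> injI df; pose p := cpr (kincl d).
have pker u : p u = 0 <-> d u = 0.
  by rewrite (rwP eqP); split=> [/eqP/cpr_exact/kincl_exact|/kincl_exact/cpr_exact/eqP].
have [|u /pker//|d' d'E] := @lfactor _ _ _ _ p d; first exact: cpr_surj.
have [|u /pker/df//|f' f'E] := @lfactor _ _ _ _ p f; first exact: cpr_surj.
have [|h hE] := injI _ _ d' f'; last first.
  by exists h => u; rewrite -d'E -f'E; apply: hE.
move=> x y; have [u <-] := cpr_surj x; have [v <-] := cpr_surj y.
rewrite !d'E => duv; apply/eqP; rewrite -subr_eq0 -linearB; apply/eqP/pker.
by rewrite linearB duv subrr.
Qed.

Lemma int_ideal_principal (J : int^o -> Prop) : submodule J ->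
  exists d : int, J d /\ forall k : int, J k -> exists q : int, k = q * d.
Proof.
move=> subJ; have JD a k l : J k -> J l -> J (a * k + l) := @subJ.2 a k l.
have [[n0 Jn0]|nJ] := pselect (exists n : nat, J (n.+1%:Z)); last first.
  exists 0; split=> [|k Jk]; first exact: subJ.1.
  exists 0; rewrite mulr0; case: k Jk => [[//|n]|n] Jn; case: nJ; exists n => //.
  by have := JD (-1) _ 0 Jn subJ.1; rewrite addr0 NegzE mulN1r opprK.
have exP : exists n : nat, `[< J (n.+1%:Z) >] by exists n0; apply/asboolP.
have [n /asboolP Jn minn] := ex_minnP exP.
exists n.+1; split=> // k Jk; exists (k %/ n.+1)%Z.
have Dr := divz_eq k n.+1.
have := modz_ge0 k (isT : n.+1%:Z != 0).
have := ltz_pmod k (isT : 0 < n.+1%:Z); move: Dr.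
case: (k %% n.+1)%Z => [[|r]|//] Dr ltrn _; first by rewrite {1}Dr addr0.
have Jr : J r.+1%:Z.
  have := JD (- (k %/ n.+1)%Z) _ _ Jn Jk; rewrite [X in _ + X]Dr addrA mulNr addNr.
  by rewrite add0r.
have /minn : `[< J r.+1%:Z >] by apply/asboolP.
by rewrite leqNgt; move: ltrn; rewrite ltz_nat ltnS => ->.
Qed.

Definition divisible (D : zmodType) :=
  forall (x : D) (n : int), n != 0 -> exists y : D, x = y *~ n.

Lemma divisible_baer (D : zmodType) :
  divisible D -> baer_module (zmodule D : lmodType int).
Proof.
move=> divD J f subJ fP; have [d [Jd dJ]] := int_ideal_principal subJ.
have f0 : f 0 = 0.
  have := fP (-1) 0 0 subJ.1 subJ.1.
  by rewrite scaler0 addr0 => {1}->; rewrite scaleN1r addNr.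
have fM q : f (q * d) = q *: f d.
  by have := fP q d 0 Jd subJ.1; rewrite f0 !addr0.
have [d0|nzd] := eqVneq d 0.
  exists 0 => u /dJ[q ->]; by rewrite fM d0 f0 !scaler0.
have [y Dy] := divD (f d) d nzd.
by exists y => u /dJ[q ->]; rewrite fM -scalerA; congr (_ *: _).
Qed.

Definition rat_mod_int : zmodType :=
  acoker (intr : {additive int -> rat}).

Definition rat_pr : {additive rat -> rat_mod_int} := apr (intr : {additive int -> rat}).

Lemma rat_mod_int_divisible : divisible rat_mod_int.
Proof.
move=> x n nzn; have [q <-] := apr_surj x; exists (rat_pr (q / n%:~R)).
by rewrite -raddfMz -mulrzr divfK // intr_eq0.
Qed.

Lemma fun_divisible (T : Type) (D : zmodType) : divisible D -> divisible (T -> D).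
Proof.
move=> divD f n nzn.
have /choice[g gE] t := divD (f t) n nzn.
exists g; apply: funext => t; rewrite gE.
have evP : zmod_morphism (fun h : T -> D => h t) by [].
exact: esym (raddfMz (mkadd evP) n g).
Qed.

(** A nonzero element m generates a cyclic group of order d, mapped to the
    rationals modulo the integers by sending m to 1/d, or to 1/2 when the order
    is infinite. *)
Lemma rat_mod_int_separates (M : zmodType) (m : M) : m != 0 ->
  exists chi : {linear (zmodule M : lmodType int) ->
                       (zmodule rat_mod_int : lmodType int)}, chi m != 0.
Proof.
move=> nzm; pose J (k : int^o) := m *~ k = 0.
have [|d [Jd dJ]] := @int_ideal_principal J.
  split=> [|a k l Jk Jl]; first exact: mulr0z.
  by rewrite /J mulrzDr -[a *: k]/(a * k) mulrC mulrzA Jk Jl mul0rz addr0.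
pose q : rat := if d == 0 then 2%:R^-1 else d%:~R^-1.
pose G (z : (zmodule M * zmodule rat_mod_int)%type) :=
  exists k : int, z = (m *~ k, rat_pr (q *~ k)).
have [||chi chiE] := @partial_lin_total int (zmodule M) (zmodule rat_mod_int) G.
- exact: divisible_baer rat_mod_int_divisible.
- split=> [|y [k [/esym/dJ[l ->] ->]]].
    split=> [|a _ _ [k ->] [l ->]]; first by exists 0; rewrite !mulr0z raddf0.
    exists (a * k + l).
    have mulzE (V : zmodType) (x : V) : x *~ (a * k + l) = x *~ k *~ a + x *~ l.
      by rewrite mulrzDr [a * k]mulrC mulrzA.
    by rewrite !mulzE raddfD (raddfMz rat_pr a).
  apply/apr_eq0.
  rewrite /q; case: eqP => [->|/eqP nzd]; first by exists 0; rewrite mulr0 mulr0z.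
  by exists l; rewrite -mulrzr intrM mulrCA mulVf ?mulr1 // intr_eq0.
exists chi; rewrite (chiE m (rat_pr q)); last by exists 1.
apply/eqP => /apr_eq0[l]; rewrite /q; case: eqP => [_|/eqP nzd] lE.
  have : (l * 2)%:~R = 1%:~R :> rat by rewrite intrM lE mulVf.
  by move/intr_inj; case: l {lE} => [[|[|l]]|[|l]].
have : (l * d)%:~R = 1%:~R :> rat by rewrite intrM lE mulVf // intr_eq0.
move/intr_inj => ld1; move: nzm; rewrite -[m]mulr1z -ld1 mulrC mulrzA Jd.
by rewrite mul0rz eqxx.
Qed.

(** ** Coinduced modules *)

Section Coinduced.
Variables (B : pzRingType) (D : zmodType).

(** The coinduced module Hom_Z(B, D), on which B acts by right multiplication of
    the argument. *)
Definition coind : Type :=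
  {linear (zmodule B : lmodType int) -> (zmodule D : lmodType int)}.
HB.instance Definition _ := GRing.Zmodule.on coind.

Fact mulr_int_linear (b : B) :
  linear (fun a : (zmodule B : lmodType int) => (a : B) * b : (zmodule B : lmodType int)).
Proof.
by move=> k x y; rewrite -[k *: x]/(x *~ k) mulrDl mulrzAl.
Qed.
Definition mulr_int (b : B) : {linear (zmodule B : lmodType int) ->
  (zmodule B : lmodType int)} := mklin (mulr_int_linear b).

Definition coind_scale (b : B) (f : coind) : coind := lcomp f (mulr_int b).
Fact coind_scaleA a b f : coind_scale a (coind_scale b f) = coind_scale (a * b) f.
Proof. by apply: linearext => x /=; rewrite mulrA. Qed.
Fact coind_scale1 : left_id 1 coind_scale.
Proof. by move=> f; apply: linearext => x /=; rewrite mulr1. Qed.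
Fact coind_scaleDr : right_distributive coind_scale +%R.
Proof. by move=> a f g; apply: linearext. Qed.
Fact coind_scaleDl f : {morph coind_scale^~ f : a b / a + b}.
Proof.
move=> a b; apply: linearext => x.
by rewrite -[LHS]/(f (x * (a + b))) mulrDr -[LHS]/(f (x * a + x * b)) linearD.
Qed.
HB.instance Definition _ := GRing.Zmodule_isLmodule.Build B coind
  coind_scaleA coind_scale1 coind_scaleDr coind_scaleDl.

Lemma coind_scaleE b (f : coind) a : (b *: f : coind) a = f (a * b).
Proof. by []. Qed.

Lemma int_linear (V : zmodType) (f : V -> D) : zmod_morphism f ->
  linear (f : (zmodule V : lmodType int) -> (zmodule D : lmodType int)).
Proof.
move=> fB k x y; pose F := mkadd fB.
by rewrite -[LHS]/(F (x *~ k + y)) raddfD raddfMz.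
Qed.

Lemma additive_of_int_linear (V : zmodType)
    (f : {linear (zmodule V : lmodType int) -> (zmodule D : lmodType int)}) :
  zmod_morphism (f : V -> D).
Proof. by move=> x y; exact: (linearB f). Qed.

(** Coinduction is right adjoint to the restriction to abelian groups, so that
    it carries injective groups to injective modules. *)
Lemma coind_map (V : lmodType B)
    (f : {linear (zmodule V : lmodType int) -> (zmodule D : lmodType int)}) :
  exists h : {linear V -> coind}, forall v a, h v a = f (a *: v).
Proof.
have fE v : linear ((fun a : B => f (a *: v)) :
    (zmodule B : lmodType int) -> (zmodule D : lmodType int)).
  apply: int_linear => a b.
  by rewrite scalerBl; exact: additive_of_int_linear.
pose h v : coind := mklin (fE v).
have hP : linear h.
  move=> b u v; apply: linearext => a.
  rewrite -[LHS]/(f (a *: (b *: u + v))) scalerDr scalerA.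
  exact: (linearD f).
by exists (mklin hP).
Qed.

Lemma coind_injective : divisible D -> injective_module (coind : lmodType B).
Proof.
move=> /divisible_baer/injective_of_baer injD U V g f injg.
have evP : linear ((fun u : U => f u 1) :
    (zmodule U : lmodType int) -> (zmodule D : lmodType int)).
  by apply: int_linear => u v; rewrite linearB.
have gP : linear ((g : U -> V) : (zmodule U : lmodType int) -> (zmodule V : lmodType int)).
  by move=> k x y; rewrite -[LHS]/(g (x *~ k + y)) raddfD raddfMz.
have [F FE] := injD (zmodule U) (zmodule V) (mklin gP) (mklin evP) injg.
have [h hE] := coind_map F; exists h => u; apply: linearext => a.
rewrite /= hE -linearZ -[LHS]/((F \o mklin gP) (a *: u)) FE /= linearZ.
by rewrite coind_scaleE mul1r.
Qed.

End Coinduced.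

(** M embeds into the divisible group D of all functions on its characters, and
    this additive embedding corresponds to an embedding into the module
    coinduced from D. *)
Lemma enough_injectives (B : pzRingType) (M : lmodType B) :
  exists (I : lmodType B) (e : {linear M -> I}), injective_module I /\ injective e.
Proof.
pose D : zmodType := {linear (zmodule M : lmodType int) ->
  (zmodule rat_mod_int : lmodType int)} -> rat_mod_int.
pose ev (m : M) : D := fun chi => chi m.
have evP : linear (ev : (zmodule M : lmodType int) -> (zmodule D : lmodType int)).
  by apply: int_linear => x y; apply: funext => chi; exact: (linearB chi).
have [e eE] := coind_map (mklin evP); exists (coind B D), e; split.
  by apply: coind_injective; apply: fun_divisible; exact: rat_mod_int_divisible.
suff ker0 m : e m = 0 -> m = 0.
  move=> x y exy; apply/eqP; rewrite -subr_eq0; apply/eqP/ker0.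
  by rewrite linearB exy subrr.
move=> em0; apply: contrapT => /eqP/rat_mod_int_separates[chi /eqP[]].
have := eE m 1; rewrite em0 scale1r => /(congr1 (fun h : D => h chi)) evm.
exact: esym evm.
Qed.

(** * Projectivization *)

Section FiniteFunctions.
Context {B : pzRingType} (U : lmodType B) (n : nat).

Fact ffun_proj_linear (j : 'I_n) : linear (fun u : {ffun 'I_n -> U} => u j).
Proof. by move=> a u v; rewrite !ffunE. Qed.
Definition ffun_proj j := mklin (ffun_proj_linear j).

Fact ffun_inj_linear (j : 'I_n) :
  linear (fun x : U => [ffun k => if k == j then x else 0] : {ffun 'I_n -> U}).
Proof.
by move=> a u v; apply/ffunP=> k; rewrite !ffunE; case: eqP; rewrite ?scaler0 ?addr0.
Qed.
Definition ffun_inj j := mklin (ffun_inj_linear j).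

Lemma ffun_sum (u : {ffun 'I_n -> U}) : u = \sum_j ffun_inj j (ffun_proj j u).
Proof.
apply/ffunP=> k; rewrite sum_ffunE (bigD1 k) //= ffunE eqxx big1 ?addr0 // => j nkj.
by rewrite ffunE eq_sym (negPf nkj).
Qed.

Lemma ffun_fg : fin_gen U -> fin_gen {ffun 'I_n -> U}.
Proof.
move=> [s Us]; exists [seq ffun_inj j x | j <- enum 'I_n, x <- s] => u.
rewrite [u]ffun_sum; apply: (big_ind (span _)) => [|v w|j _].
- exact: (span_submodule _).1.
- by apply: submD; apply: span_submodule.
apply: (span_min (submodule_preim _ (span_submodule _)) _ (Us _)) => x sx.
by apply: mem_span; apply: allpairs_f; rewrite ?mem_enum.
Qed.

End FiniteFunctions.

Section Projectivization.
Context {B : pzRingType} {C : subcat B} {X : obj C}.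
Hypothesis genX : additive_generator C X.
Local Notation Gamma := (endo X).
Implicit Types Y Z : lmodType B.

Definition homX (Y : lmodType B) : rmodType Gamma := eval (homf C Y) X.

Fact postX_linear Y Z (f : {linear Y -> Z}) :
  linear (fun g : homX Y => lcomp f g : homX Z).
Proof. by move=> a g h; apply: linearext => x /=; rewrite linearD. Qed.
Definition postX Y Z (f : {linear Y -> Z}) : {linear homX Y -> homX Z} :=
  mklin (postX_linear f).

Lemma factor_sum Y : C Y -> exists n (p : 'I_n -> {linear Y -> X})
  (s : 'I_n -> {linear X -> Y}), forall y, y = \sum_i s i (p i y).
Proof.
move=> /genX[n [W [f [g fK gK]]]]; have [i [p [iK _ _]]] := pair_splits fK gK.
exists n, (fun j => lcomp (ffun_proj X j) i), (fun j => lcomp p (ffun_inj X j)) => y.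
by rewrite /= -linear_sum -ffun_sum iK.
Qed.

(** Precomposing the decomposition of the identity of Y with g expresses g in
    the generators s of Hom(X, Y), with coefficients linear in g. *)
Lemma homX_dual_basis Y : C Y -> exists n (p : 'I_n -> {linear Y -> X})
  (s : 'I_n -> homX Y), (forall y, y = \sum_i s i (p i y)) /\
    forall g : homX Y, g = \sum_i (lcomp (p i) g : Gamma^c) *: s i.
Proof.
move=> /factor_sum[n [p [s ps]]]; exists n, p, s; split=> // g.
apply: linearext => x; rewrite [LHS]ps.
by elim/big_rec2: _ => // i y h _ ->.
Qed.

Lemma homX_fg Y : C Y -> fin_gen (homX Y).
Proof.
move=> /homX_dual_basis[n [p [s [_ gE]]]]; exists [seq s i | i <- enum 'I_n] => g.
rewrite [g]gE; apply: (big_ind (span _)) => [|u v|i _].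
- exact: (span_submodule _).1.
- by apply: submD; apply: span_submodule.
apply: submZ; first exact: span_submodule.
by apply: mem_span; apply: map_f; rewrite mem_enum.
Qed.

Lemma homX_projective Y : C Y -> projective (homX Y).
Proof.
move=> /homX_dual_basis[n [p [s [_ gE]]]] U V q f surjq.
have /choice[u uE] i := surjq (f (s i)).
have hP : linear (fun g : homX Y => \sum_i (lcomp (p i) g : Gamma^c) *: u i).
  move=> a g h; rewrite scaler_sumr -big_split; apply: eq_bigr => i _ /=.
  rewrite scalerA -scalerDl; congr (_ *: _); apply: linearext => x /=.
  by rewrite linearD.
exists (mklin hP) => g; rewrite /= [in RHS](gE g) !linear_sum.
by apply: eq_bigr => i _; rewrite !linearZ_LR uE.
Qed.

(** The images of the dual basis determine phi, and they assemble into f. *)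
Lemma homX_full Y Z (phi : {linear homX Y -> homX Z}) : C Y ->
  exists f : {linear Y -> Z}, forall g, phi g = postX f g.
Proof.
move=> /homX_dual_basis[n [p [s [_ gE]]]].
have fP : linear (fun y => \sum_i phi (s i) (p i y)).
  move=> a x y; rewrite scaler_sumr -big_split; apply: eq_bigr => i _ /=.
  by rewrite !linearP.
exists (mklin fP) => g; rewrite [in LHS](gE g) linear_sum.
apply: linearext => x; rewrite /=.
rewrite (_ : (_ : homX Z) x = \sum_i phi (s i) (p i (g x))) //.
elim/big_rec2: _ => // i y h _ <-.
by rewrite linearZ_LR.
Qed.

Lemma homX_eq0 Y Z (f : {linear Y -> Z}) : C Y ->
  (forall g : homX Y, postX f g = 0) -> f = 0.
Proof.
move=> /factor_sum[n [p [s ps]]] f0; apply: linearext => y.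
rewrite [y]ps linear_sum big1 // => i _.
by rewrite -[LHS]/(postX f (s i) (p i y)) f0.
Qed.

End Projectivization.

(** * The module of maps that factor through a projective module *)

Section ProjectiveIdeal.
Variables (A : pzRingType) (noethA : noetherian A^c).
Variables (C : subcat A^c) (X : obj C).
Hypothesis genX : additive_generator C X.
Hypothesis perpC : forall M : rmodType A, C M -> perp M.

Variables (Q : rmodType A) (q : {linear Q -> X}).
Hypothesis CQ : C Q.
Hypothesis Qfg : fin_gen Q.
Hypothesis Qproj : projective Q.
Hypothesis q_surj : surjective q.
Hypothesis CK : C (lker q).

Local Notation Gamma := (endo X).
Local Notation homX := (@homX _ _ X).

(** T is handled through the factorization Hom(X, Q) ->> T >-> Hom(X, X) of
    composition with q only; it is the right ideal of the maps that factor
    through q. *)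
Variables (T : rmodType Gamma) (iota : {linear T -> homX X}) (pi : {linear homX Q -> T}).
Hypothesis iota_inj : injective iota.
Hypothesis pi_surj : surjective pi.
Hypothesis iota_pi : forall g : homX Q, iota (pi g) = postX q g.

Let CX : C X := omodP X.

Lemma pi_eq0 g : pi g = 0 <-> exists h : homX (lker q), postX (kincl q) h = g.
Proof.
split=> [pg0|[h <-]].
  have [|h Dh] := @kincl_lift _ _ _ q X g; last by exists h.
  by move=> x; rewrite -[LHS]/(postX q g x) -iota_pi pg0 linear0.
apply: iota_inj; rewrite iota_pi linear0; apply: linearext => x.
by apply/(@kincl_exact _ _ _ q); exists (h x).
Qed.

Lemma projideal_fg : fin_gen T.
Proof. exact: fin_gen_surj pi_surj (homX_fg genX CQ). Qed.

Lemma projideal_proj_dim : proj_dim_le1 T.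
Proof.
exists (homX (lker q)), (homX Q), (postX (kincl q)), pi; split=> //.
- exact: homX_projective.
- exact: homX_projective.
- move=> g h gh; apply: linearext => x; apply: (@kincl_inj _ _ _ q).
  by rewrite -[LHS]/(postX (kincl q) g x) gh.
- exact: pi_eq0.
Qed.

(** A map Hom(X, K) -> T is composition with some K -> Q followed by pi; since
    the first extension group of U by the projective Q vanishes, K -> Q
    extends to Z. *)
Lemma projideal_extend (K Z U : rmodType A) (i : {linear K -> Z}) (e : {linear Z -> U})
    (phi : {linear homX K -> T}) :
  C K -> C Z -> C U ->
  injective i -> exact_at i e -> surjective e ->
  exists psi : {linear homX Z -> T}, forall g, psi (postX i g) = phi g.
Proof.
move=> CK' CZ CU inji exie surje.
have [phi' Dphi] := proj_lift phi (homX_projective genX CK') pi_surj.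
have [k kE] := homX_full genX phi' CK'.
have [k' k'E] := ext1_extend_to_proj noethA (subcat_fg CZ) inji exie surje
  (@perpC _ CU 0%N) Qfg Qproj k.
exists (lcomp pi (postX k')) => g; rewrite -Dphi /= kE; congr (pi _).
by apply: linearext => x; apply: k'E.
Qed.

(** [projideal_extend] for the sequence 0 -> ker q -> Q -> X -> 0. *)
Lemma projideal_rigid : ext_succ_eq0 0 T T.
Proof.
apply: ext1_eq0_of_cover (homX_projective genX CQ) pi_surj _ => k.
have [|j jE] := @inj_lift _ _ _ _ (kincl pi) (postX (kincl q)) (@kincl_inj _ _ _ pi).
  by move=> g; apply/kincl_exact/pi_eq0; exists g.
have [psi psiE] := projideal_extend (lcomp k j) CK CQ CX (@kincl_inj _ _ _ q)
  (@kincl_exact _ _ _ q) q_surj.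
exists psi => x; have /pi_eq0[g Dg] : pi (kincl pi x) = 0.
  by apply/kincl_exact; exists x.
rewrite -Dg psiE /=; congr (k _); apply: (@kincl_inj _ _ _ pi).
by rewrite jE Dg.
Qed.

(** ** Endomorphisms *)

(** The image of iota contains the composites of q with all maps X -> Q, and
    maps from X detect zero maps on Q. *)
Lemma projideal_eq0 (Z : rmodType A) (f : {linear X -> Z}) :
  (forall t, lcomp f (iota t) = 0) -> f = 0.
Proof.
move=> f0; suff fq0 : lcomp f q = 0.
  by apply: linearext => x; have [y <-] := q_surj x; rewrite -[LHS]/(lcomp f q y) fq0.
apply: (homX_eq0 genX CQ) => g; rewrite -[RHS](f0 (pi g)) iota_pi.
exact: linearext.
Qed.

Lemma projideal_endo_of (h : endo X) :
  exists phi : endo T, forall t, iota (phi t) = postX h (iota t).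
Proof.
apply: (inj_lift (g := lcomp (postX h) iota)) => // t.
have [g <-] := pi_surj t; have [k Dk] := proj_lift (lcomp h q) Qproj q_surj.
exists (pi (postX k g)); rewrite /= !iota_pi; apply: linearext => x /=.
by rewrite -[LHS]/(lcomp q k (g x)) Dk.
Qed.

(** The endomorphism of Hom(X, Q) lifting phi is composition with some
    k : Q -> Q. Maps from X to the kernel of q, which represent the kernel of
    pi, are killed by q k, so that k induces h on X. *)
Lemma projideal_endo_surj (phi : endo T) :
  exists h : endo X, forall t, iota (phi t) = postX h (iota t).
Proof.
have [phi' Dphi] := proj_lift (lcomp phi pi) (homX_projective genX CQ) pi_surj.
have [k kE] := homX_full genX phi' CQ.
have phiE g : iota (phi (pi g)) = postX q (postX k g).
  by rewrite -iota_pi -kE -[phi _]/(lcomp phi pi g) -Dphi.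
have qk0 : lcomp q (lcomp k (kincl q)) = 0.
  apply: (homX_eq0 genX CK) => g.
  have /pi_eq0 pg0 : exists g', postX (kincl q) g' = postX (kincl q) g by exists g.
  transitivity (iota (phi (pi (postX (kincl q) g)))); last by rewrite pg0 !linear0.
  by rewrite phiE; apply: linearext.
have [//|y /(@kincl_exact _ _ _ q)[z <-]|h hE] := @lfactor _ _ _ _ q (lcomp q k).
  by rewrite -[LHS]/(lcomp q (lcomp k (kincl q)) z) qk0.
exists h => t; have [g <-] := pi_surj t; rewrite phiE iota_pi.
by apply: linearext => x /=; rewrite hE.
Qed.

Lemma projideal_num n : num_indec_summands X n -> num_indec_summands T n.
Proof.
move=> /num_indec_summandsE numX; apply/num_indec_summandsE.
have [phi phiE] := choice projideal_endo_of.
have [psi psiE] := choice projideal_endo_surj.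
apply: (num_primitive_idems_iso (phi := phi)) numX => [|h h'].
  exists psi => [h|f].
    apply/eqP; rewrite -subr_eq0; apply/eqP; apply: projideal_eq0 => t.
    apply: linearext => x.
    rewrite -[LHS]/(postX (psi (phi h)) (iota t) x - postX h (iota t) x).
    by rewrite -psiE -phiE subrr.
  by apply: linearext => t; apply: iota_inj; rewrite phiE -psiE.
apply: linearext => t; apply: iota_inj.
rewrite -[phi h * phi h']/(lcomp (phi h) (phi h')) /= !phiE.
exact: linearext.
Qed.

(** ** Injective dimension *)

(** The cokernel of T -> I satisfies Baer's condition: for an ideal J with m
    generators, f is first lifted to psi on Hom(X, X^m), which covers J, and
    then changed by a map into T so as to vanish on the kernel of the cover. *)
Lemma projideal_inj_dim : closed_under_submodules C ->
  (forall J : (Gamma^c)^o -> Prop, submodule J -> fg_sub J) -> inj_dim_le1 T.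
Proof.
move=> subC noethG; have [I [e [injI inje]]] := enough_injectives T.
exists I, (lcoker e), e, (cpr e); split=> //; last 2 first.
- exact: cpr_exact.
- exact: cpr_surj.
apply: injective_of_baer => J f subJ fP.
have [s [sJ Js]] := noethG J subJ.
pose Y : rmodType A := {ffun 'I_(size s) -> X}.
have CY : C Y by apply/genX; exists (size s); apply: summand_refl.
have dP : linear (fun y : Y => \sum_(j < size s) (s`_j : Gamma) (y j)).
  move=> a x y; rewrite scaler_sumr -big_split; apply: eq_bigr => j _ /=.
  by rewrite !ffunE linearP.
pose d : {linear Y -> X} := mklin dP.
have DP : linear (fun a : homX Y => lcomp d a : rreg Gamma) := @postX_linear _ C X _ _ d.
pose D : {linear homX Y -> rreg Gamma} := mklin DP.
have DJ a : J (D a).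
  have -> : D a = \sum_(j < size s) (lcomp (ffun_proj X j) a : Gamma^c) *: s`_j.
    apply: (@linearext _ X X) => x; rewrite /=.
    by elim/big_rec2: _ => // j y h _ ->.
  apply: (big_ind J) => [|u v|j _]; [exact: subJ.1|exact: submD|].
  by apply: submZ => //; apply: sJ; apply: mem_nth.
have D_onto u : J u -> exists a, D a = u.
  move=> /Js[c ->].
  have aP : linear (fun x : X => [ffun j : 'I_(size s) => (c j : Gamma) x] : Y).
    by move=> b x y; apply/ffunP=> j; rewrite !ffunE linearP.
  exists (mklin aP); apply: (@linearext _ X X) => x; rewrite /=.
  transitivity (\sum_(j < size s) (s`_j : Gamma) ((c j : Gamma) x)).
    by apply: eq_bigr => j _; rewrite ffunE.
  by elim/big_rec2: _ => // j y h _ ->.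
have fDP : linear (fun a : homX Y => f (D a)).
  by move=> c a b; rewrite linearP fP.
have f0 : f 0 = 0.
  by have := fP (-1) 0 0 subJ.1 subJ.1; rewrite scaler0 addr0 scaleN1r addNr.
have [psi Dpsi] := proj_lift (mklin fDP) (homX_projective genX CY) (@cpr_surj _ _ _ e).
have psiE a : cpr e (psi a) = f (D a) by rewrite -[LHS]/(lcomp _ psi a) Dpsi.
(* psi maps the kernel of D, which is Hom(X, ker d), into T *)
have DK (b : homX (lker d)) : D (postX (kincl d) b) = 0.
  apply: (@linearext _ X X) => x.
  by apply/(@kincl_exact _ _ _ d); exists (b x).
have [b|phi phiE] := @inj_lift _ _ _ _ e (lcomp psi (postX (kincl d))) inje.
  by apply/cpr_exact; apply: etrans (psiE _) _; rewrite DK f0.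
have CKd : C (lker d) by apply: subC CY; apply: kincl_inj.
(* the image of d, as the kernel of its cokernel *)
have [d' Dd'] : {d' : {linear Y -> lker (cpr d)} | lcomp (kincl (cpr d)) d' = d}.
  by apply: kincl_lift => y; apply/cpr_exact; exists y.
have d'E y : kincl (cpr d) (d' y) = d y by rewrite -[in RHS]Dd'.
have Cim : C (lker (cpr d)) by apply: subC CX; apply: kincl_inj.
have exd' : exact_at (kincl d) d'.
  move=> y; split=> [d'y0|[z <-]].
    by apply/kincl_exact; rewrite -d'E d'y0 linear0.
  apply: (@kincl_inj _ _ _ (cpr d)); rewrite d'E linear0.
  by apply/kincl_exact; exists z.
have surjd' : surjective d'.
  move=> z; have /cpr_exact[y Dy] : cpr d (kincl (cpr d) z) = 0.
    by apply/kincl_exact; exists z.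
  by exists y; apply: (@kincl_inj _ _ _ (cpr d)); rewrite d'E.
have [chi chiE] := projideal_extend phi CKd CY Cim (@kincl_inj _ _ _ d) exd' surjd'.
pose psi' : {linear homX Y -> I} := psi - lcomp e chi.
have psi'E a : psi' a = psi a - e (chi a) by [].
have [a Da0|h hE] := @injective_extend _ _ _ _ D psi' injI.
  have [x|b Db] := @kincl_lift _ _ _ d X a.
    by rewrite -[LHS]/((D a : Gamma) x) Da0.
  have <- : postX (kincl d) b = a := Db.
  by rewrite psi'E chiE phiE subrr.
exists (cpr e (h (1 : Gamma))) => u /D_onto[a <-].
rewrite -linearZ_LR -[_ *: _]linearZ_LR.
have -> : (D a : Gamma^c) *: ((1 : Gamma) : rreg Gamma) = D a := mul1r (D a : Gamma).
rewrite hE psi'E linearB psiE.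
have -> : cpr e (e (chi a)) = 0 by apply/cpr_exact; exists (chi a).
by rewrite subr0.
Qed.

End ProjectiveIdeal.

(** The endomorphisms of the right regular module are the left
    multiplications. *)
Lemma num_primitive_idems_reg (A : pzRingType) n :
  num_primitive_idems A n -> num_indec_summands (rreg A) n.
Proof.
move=> numA; apply/num_indec_summandsE.
have mulP (a : A) : linear (fun x : rreg A => a * (x : A) : rreg A).
  by move=> b x y; rewrite -[LHS]/(a * ((x : A) * b + (y : A))) mulrDr mulrA.
apply: (num_primitive_idems_iso (phi := fun a => mklin (mulP a) : endo (rreg A))) numA.
  exists (fun f : endo (rreg A) => f (1 : A)) => [a|f]; first exact: (@mulr1 A a).
  apply: (@linearext _ (rreg A) (rreg A)) => x.
  rewrite -[LHS]/((x : A^c) *: f (1 : A)) -linearZ_LR; congr (f _).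
  exact: (@mul1r A x).
by move=> a b; apply: (@linearext _ (rreg A) (rreg A)) => x; exact/esym/(@mulrA A).
Qed.

(** * Right ideals of the endomorphism ring are finitely generated *)

Section EndoNoetherian.
Variables (R : comPzRingType) (L : algType R) (artL : artin_algebra L).
Variables (X : rmodType L) (Xfg : fin_gen X).
Local Notation Gamma := (endo X).

Fact central_linear (r : R) : linear (fun x : X => (r%:A : L^c) *: x).
Proof.
move=> a x y; rewrite scalerDr !scalerA; congr (_ *: _ + _).
by rewrite -[LHS]/((a : L) * r%:A) -[RHS]/((r%:A : L) * a) mulr_algl mulr_algr.
Qed.
Definition central (r : R) : Gamma := mklin (central_linear r).

(** An endomorphism is determined by its values on finitely many generators of
    X, so that a right ideal is a submodule of a finitely generated module over
    the artinian base ring. *)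
Lemma right_ideal_fg (J : (Gamma^c)^o -> Prop) : submodule J -> fg_sub J.
Proof.
move=> subJ; have [artR Lfg] := artL; have [s Xs] := Xfg.
pose V : lmodType R := {ffun 'I_(size s) -> restr X}.
have [t Vt] : fin_gen V by apply/ffun_fg/fin_gen_restr.
pose ev (h : Gamma) : V := [ffun i : 'I_(size s) => h s`_i].
have ev_inj h h' : ev h = ev h' -> h = h'.
  move=> evh; apply: linearext => x; apply/eqP; rewrite -subr_eq0; apply/eqP.
  have subK : submodule (fun x => (h - h') x = 0).
    by split=> [|a u v hu hv]; rewrite ?linear0 // linearP hu hv scaler0 addr0.
  apply: (span_min subK _ (Xs x)) => u /(nthP 0)[i ltis <-].
  have := congr1 (fun f : V => f (Ordinal ltis)) evh.
  by rewrite !ffunE /= => ->; rewrite subrr.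
have evD h h' : ev (h + h') = ev h + ev h' by apply/ffunP=> i; rewrite !ffunE.
have evZ r h : ev (h * central r) = r *: ev h.
  apply/ffunP=> i; rewrite !ffunE -[LHS]/(h ((r%:A : L^c) *: s`_i)).
  exact: linearZ_LR.
have ev0 : ev 0 = 0 by apply/ffunP=> i; rewrite !ffunE.
have subJD h h' : J h -> J h' -> J (h + h') by apply: submD subJ.
have subJM (h g : Gamma) : J h -> J (h * g) by apply: (submZ (g : Gamma^c) subJ).
pose S (v : V) := exists h : Gamma, J h /\ ev h = v.
have subS : submodule S.
  split=> [|r _ _ [h [Jh <-]] [h' [Jh' <-]]]; first by exists 0; split; [exact: subJ.1|].
  exists (h * central r + h'); rewrite evD evZ; split=> //.
  by apply: subJD => //; apply: subJM.
have [u [uS Su]] := artinian_fg_sub artR subS (fun v _ => Vt v).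
have /choice[g gE] v : exists h : Gamma, S v -> J h /\ ev h = v.
  by have [[h hE]|nS] := pselect (S v); [exists h|exists 0].
exists (map g u : seq (Gamma^c)^o); split=> [_ /mapP[v uv ->]|h Jh].
  exact: (gE v (uS v uv)).1.
have subG := @span_submodule _ (Gamma^c)^o (map g u).
suff [h' [spanh' /ev_inj <-]] : exists h' : Gamma,
  span (map g u : seq (Gamma^c)^o) h' /\ ev h' = ev h by [].
apply: (@span_min _ V (fun v => exists h' : Gamma,
  span (map g u : seq (Gamma^c)^o) h' /\ ev h' = v) u) => [|v uv|]; last first.
- by apply: Su; exists h.
- exists (g v); split; last exact: (gE v (uS v uv)).2.
  exact/mem_span/map_f.
split=> [|r _ _ [h1 [sh1 <-]] [h2 [sh2 <-]]].
  by exists 0; split; [exact: subG.1|].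
exists (h1 * central r + h2); rewrite evD evZ; split=> //.
exact: (subG.2 (central r : Gamma^c) h1 h2).
Qed.

End EndoNoetherian.

(** * The intermediate extension *)

Section Zeta.
Context {B : pzRingType} {C : subcat B}.
Variables (noethB : noetherian B) (cfC : contravariantly_finite C).
Variables (prjC : contains_projectives C) (M : obj (modcat B)) (X : obj C).

Local Notation zetaM := (eval (zeta noethB cfC prjC M) X).
Local Notation P := (ppres noethB M).

(** By naturality only the image of the identity of Q matters, and the
    adjunction, under which gamma corresponds to the inverse of the counit,
    identifies it with the cover Q -> M. *)
Lemma gamma_apr (Y : obj C) (g : {linear Y -> qQ P}) :
  gamma noethB cfC prjC M Y (apr (postcomp (qd P) Y) g) = lcomp (qe P) g.
Proof.
pose lam := lambda_pres noethB prjC M.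
have gamma_id : gamma noethB cfC prjC M (pX0 lam) (pp lam _ (lid _)) = qe P.
  have [f Df] := pp_surj (pres (theta_rho noethB cfC M))
    (gamma noethB cfC prjC M (pX0 lam) (pp lam _ (lid _))).
  rewrite -Df pres_mapE; apply: linearext => x.
  rewrite -[LHS]/(pres_map noethB cfC M (f x)) -counit_rhoE -(adj_lambdaE Df).
  by rewrite gammaE counit_rhoVK.
have -> : apr (postcomp (qd P) Y) g =
    fmap (cokf C (qd P)) (Z := pX0 lam) g (pp lam _ (lid _)).
  by rewrite -ntnat; congr (apr _ _); apply: linearext.
by rewrite ntnat gamma_id.
Qed.

Lemma zeta_image : exists (iota : {linear zetaM -> homX (X := X) M})
    (pi : {linear homX (X := X) (qQ P) -> zetaM}),
  [/\ injective iota, surjective pi & forall g, iota (pi g) = postX (qe P) g].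
Proof.
have iotaP : linear (fun t : zetaM => val t : homX (X := X) M) by [].
pose iota := mklin iotaP.
have iota_inj : injective iota by exact: val_inj.
have [g|pi piE] := @inj_lift _ _ _ _ iota (postX (qe P)) iota_inj.
  have im : (postX (qe P) g) \in in_aim (gamma noethB cfC prjC M X).
    by apply/in_aimP; exists (apr (postcomp (qd P) X) g); apply: gamma_apr.
  by exists (exist (fun v => v \in in_aim _) _ im).
exists iota, pi; split=> // t; have /in_aimP[y Dy] := valP t.
have [g Dg] := apr_surj y; exists g; apply: iota_inj.
by rewrite piE -[RHS]Dy -Dg gamma_apr.
Qed.

End Zeta.

Theorem theorem3p13 (R : comPzRingType) (L : algType R)
    (artL : artin_algebra L) (C : subcat L^c)
    (cfC : contravariantly_finite C) (prjC : contains_projectives C)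
    (perpC : forall M : rmodType L, C M -> perp M)
    (ftC : finite_type C) (X : obj C) (genX : additive_generator C X) :
  let Gamma : pzRingType := endo X in
  let T : rmodType Gamma :=
    eval (zeta (artin_noetherian artL) cfC prjC (to_mod X)) X in
  (closed_under_syzygies C -> tilting T) /\
  (closed_under_syzygies C -> closed_under_submodules C -> cotilting T).
Proof.
move=> Gamma T; set noethL := artin_noetherian artL.
pose P := ppres noethL (to_mod X).
have [iota [pi [iota_inj pi_surj iota_pi]]] :=
  zeta_image noethL cfC prjC (to_mod X) X.
have CX : C X := omodP X.
have CQ : C (qQ P) by exact: prjC (qQ_fg P) (qQ_proj (p := P)).
have syzygy : closed_under_syzygies C -> C (lker (qe P)).
  move=> syzC; apply: (syzC _ _ _ (kincl (qe P)) (qe P)) CX.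
  - by apply: lker_fg; [exact: noethL|exact: qQ_fg].
  - exact: qQ_fg.
  - exact: qQ_proj.
  - exact: kincl_inj.
  - exact: kincl_exact.
  - exact: q_surj.
have counts : closed_under_syzygies C ->
    exists n, num_indec_summands T n /\ num_indec_summands (rreg Gamma) n.
  move=> /syzygy CK; have [n nX] := num_indec_summands_exists ftC genX.
  exists n; split; last exact/num_primitive_idems_reg/num_indec_summandsE.
  exact: (projideal_num genX CQ (qQ_proj (p := P)) (@q_surj _ _ P) CK iota_inj pi_surj).
have fgT : fin_gen T by exact: (projideal_fg genX CQ pi_surj).
have rigidT : closed_under_syzygies C -> ext_succ_eq0 0 T T.
  move=> /syzygy CK; exact: (projideal_rigid noethL genX perpC CQ (qQ_fg P)
    (qQ_proj (p := P)) (@q_surj _ _ P) CK iota_inj pi_surj).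
split=> [syzC|syzC subC]; split; try by [apply: rigidT|apply: counts|].
  exact: (projideal_proj_dim genX CQ (syzygy syzC) iota_inj pi_surj).
apply: (projideal_inj_dim noethL genX perpC (qQ_fg P) (qQ_proj (p := P)) pi_surj subC).
by apply: (right_ideal_fg artL); exact: subcat_fg CX.
Qed.
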